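(* For every $s\in\mathbb{R}_{>0}^3$ there is a constant $C>0$ depending only on $s$ such that for all integers $n\ge2$, $$\left(1-\frac{C\log n}{n}\right)\mathbf f(s)\le\mathbf f_n(s)\le\left(1+\frac{C\log n}{n}\right)\mathbf f(s).$$
   Context: For an integer $n\ge1$ let $V(\mathbb{T}_n)=(\mathbb{Z}/n\mathbb{Z})^2$ be the vertex set of the discrete torus obtained from the triangular lattice $\mathbb{Z}+\mathbb{Z}\omega$, $\omega=e^{2\pi i/3}$, modulo $n$ (with $1\mapsto(1,0)$, $\omega\mapsto(0,1)$). For $f:V(\mathbb{T}_n)\to\mathbb{R}$ the discrete Hessian on the three families $E_0,E_1,E_2$ of unit rhombi is given by $D_0f(a,b)=f(a,b)+f(a+2,b+1)-f(a+1,b)-f(a+1,b+1)$, $D_1f(a,b)=f(a+1,b)+f(a,b+1)-f(a,b)-f(a+1,b+1)$, $D_2f(a,b)=f(a,b)+f(a+1,b+2)-f(a+1,b+1)-f(a,b+1)$. For $s=(s_0,s_1,s_2)\in\mathbb{R}_{>0}^3$, $P_n(s)$ is the bounded convex polytope of all $g:V(\mathbb{T}_n)\to\mathbb{R}$ with $\sum_v g(v)=0$ and $D_rg(v)\le s_r$ for all $v$ and $r\in\{0,1,2\}$; $|P_n(s)|$ is its $(n^2-1)$-dimensional Lebesgue measure in the hyperplane of mean-zero functions. For $n\ge2$, $\mathbf f_n(s)=|P_n(s)|^{1/(n^2-1)}$, and $\mathbf f(s)=\lim_{n\to\infty}\mathbf f_n(s)$ (the limit exists). *)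

(* Defs.v *)
From HB Require Import structures.
From mathcomp Require Import all_boot all_order all_algebra.
From mathcomp Require Import all_classical all_reals all_analysis.

Set Implicit Arguments.
Unset Strict Implicit.
Unset Printing Implicit Defensive.

Import Order.TTheory GRing.Theory Num.Theory.
Import numFieldNormedType.Exports.

Local Open Scope classical_set_scope.
Local Open Scope ring_scope.

Section lebesgue_cons.
Local Open Scope ereal_scope.
Context (R : realType) (d : nat).
Local Notation RT := (measurableTypeR R).
Variable m : {sigma_finite_measure set (d.-tuple RT) -> \bar R}.

Definition cons_pair (p : RT * d.-tuple RT) : d.+1.-tuple RT :=
  [tuple of p.1 :: p.2].

Definition uncons (t : d.+1.-tuple RT) : RT * d.-tuple RT :=
  (thead t, [tuple of behead t]).

Lemma cons_pairK : cancel cons_pair uncons.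
Proof. by case=> x t; rewrite /uncons theadE; congr pair; exact/val_inj. Qed.

Lemma measurable_cons_pair : measurable_fun [set: RT * d.-tuple RT] cons_pair.
Proof. exact: measurable_cons. Qed.

Lemma measurable_uncons : measurable_fun [set: d.+1.-tuple RT] uncons.
Proof.
apply/measurable_fun_pairP; split.
- exact: (measurable_tnth ord0).
- exact: measurable_behead.
Qed.

Definition lebesgue_cons : set (d.+1.-tuple RT) -> \bar R :=
  pushforward (@lebesgue_measure R \x m) cons_pair.

HB.instance Definition _ := Measure.copy lebesgue_cons
  (measure_function_pushforward__canonical__measure_function_Measure
     (@lebesgue_measure R \x m) measurable_cons_pair).

Lemma lebesgue_cons_sigma_finite : sigma_finite setT lebesgue_cons.
Proof.
have /sigma_finiteP[F [TF ndF mF]] := sigma_finiteT (@lebesgue_measure R).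
have /sigma_finiteP[G [TG ndG mG]] := sigma_finiteT m.
exists (fun n => uncons @^-1` (F n `*` G n)).
  rewrite -preimage_bigcup (_ : \bigcup_n _ = setT) ?preimage_setT//.
  apply/seteqP; split=> // -[x y] _.
  have [i _ Fix] : (\bigcup_n F n) x by rewrite -TF.
  have [j _ Gjy] : (\bigcup_n G n) y by rewrite -TG.
  exists (maxn i j) => //; split.
    by move: x Fix; exact/subsetPset/ndF/leq_maxl.
  by move: y Gjy; exact/subsetPset/ndG/leq_maxr.
move=> n; have [mFn Fnoo] := mF n; have [mGn Gnoo] := mG n; split.
  rewrite -[X in measurable X]setTI; apply: measurable_uncons => //.
  exact: measurableX.
rewrite /lebesgue_cons /pushforward -comp_preimage.
rewrite (_ : uncons \o cons_pair = id); last first.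
  by apply/funext => p /=; rewrite cons_pairK.
by rewrite preimage_id product_measure1E// lte_mul_pinfty// ge0_fin_numE.
Qed.

HB.instance Definition _ := Measure_isSigmaFinite.Build _ _ _ lebesgue_cons
  lebesgue_cons_sigma_finite.

End lebesgue_cons.

(* Lebesgue measure on R^d; lebesgue_tuple_box below checks it on boxes. *)
Fixpoint lebesgue_tuple (R : realType) (d : nat) :
    {sigma_finite_measure set (d.-tuple (measurableTypeR R)) -> \bar R} :=
  match d with
  | 0 => \d_([tuple] : 0.-tuple (measurableTypeR R))
  | d'.+1 => lebesgue_cons (lebesgue_tuple R d')
  end.

Lemma measurable_box (R : realType) (d : nat)
    (A : 'I_d -> set (measurableTypeR R)) :
  (forall i, measurable (A i)) ->
  measurable [set t : d.-tuple (measurableTypeR R) | forall i, A i (tnth t i)].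
Proof.
move=> mA; rewrite (_ : mkset _ =
    \bigcap_(i in [set: 'I_d]) ((@tnth _ _)^~ i @^-1` A i)).
  apply: fin_bigcap_measurable => // i _.
  by rewrite -[X in measurable X]setTI; exact: measurable_tnth.
by apply/seteqP; split=> t /= h i; [move=> _|]; exact: h.
Qed.

Lemma lebesgue_tuple_box (R : realType) (d : nat)
    (A : 'I_d -> set (measurableTypeR R)) :
  (forall i, measurable (A i)) ->
  (lebesgue_tuple R d [set t | forall i, A i (tnth t i)] =
   \prod_(i < d) lebesgue_measure (A i))%E.
Proof.
elim: d A => [|d IHd] A mA.
  rewrite big_ord0 /= diracE mem_set//= => -[].
  by case.
rewrite big_ord_recl -IHd//= /lebesgue_cons /pushforward.
rewrite -product_measure1E//; last first.
  by apply: (@measurable_box _ _ (fun i => A (lift ord0 i))) => i; exact: mA.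
congr (_ \x _)%E; apply/seteqP; split=> -[x t] /= h.
- split; first by have := h ord0.
  by move=> i; have := h (lift ord0 i); rewrite tnthS.
- case: h => h0 hS i; case: (unliftP ord0 i) => [j ->|->//].
  by rewrite tnthS; exact: hS.
Qed.

(* The k-dimensional Lebesgue measure on the span of k linearly independent    *)
(* vectors b_0, ..., b_(k-1) of the Euclidean space R^T: the coordinate map    *)
(* multiplies k-dimensional volume by the square root of the Gram determinant, *)
(* so the result does not depend on the choice of the basis b.                 *)
Definition span_measure (R : realType) (T : finType) (k : nat)
    (b : 'I_k -> T -> R) (S : set (T -> R)) : \bar R :=
  let gram := \matrix_(i < k, j < k) \sum_x b i x * b j x in
  let comb (t : k.-tuple R) x := \sum_(i < k) tnth t i * b i x in
  ((Num.sqrt (\det gram))%:E * lebesgue_tuple R k (comb @^-1` S))%E.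

(* (Z/nZ)^2, with Z/nZ represented by 'I_n: the map ordS is +1 modulo n for    *)
(* every n, whereas 'Z_n would have two elements for n = 1.                    *)
Definition torus (n : nat) : finType := ('I_n * 'I_n)%type.

(* The basis (delta_(v_(i+1)) - delta_(v_0))_(i < n^2 - 1) of the mean-zero    *)
(* functions, where v_0, ..., v_(n^2-1) lists the torus in row-major order.    *)
Definition mean_zero_basis (R : realType) (n : nat) (i : 'I_(n ^ 2 - 1))
    (v : torus n) : R :=
  (v.1 * n + v.2 == i.+1)%N%:R - (v.1 * n + v.2 == 0)%N%:R.

Definition hessian (R : realType) (n : nat) (r : 'I_3) (f : torus n -> R)
    (v : torus n) : R :=
  let: (a, b) := v in
  match val r with
  | 0 => f (a, b) + f (ordS (ordS a), ordS b)
         - f (ordS a, b) - f (ordS a, ordS b)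
  | 1 => f (ordS a, b) + f (a, ordS b) - f (a, b) - f (ordS a, ordS b)
  | _ => f (a, b) + f (ordS a, ordS (ordS b))
         - f (ordS a, ordS b) - f (a, ordS b)
  end.

Definition hessian_polytope (R : realType) (n : nat) (s : 'I_3 -> R) :
    set (torus n -> R) :=
  [set g | \sum_v g v = 0 /\ forall r v, hessian r g v <= s r].

Definition polytope_volume (R : realType) (n : nat) (s : 'I_3 -> R) : \bar R :=
  span_measure (@mean_zero_basis R n) (@hessian_polytope R n s).

(* f_n(s); the polytope is bounded, so [fine] only changes the type.           *)
Definition volume_root (R : realType) (s : 'I_3 -> R) (n : nat) : R :=
  fine (polytope_volume n s) `^ ((n ^ 2 - 1)%N%:R^-1).

Definition volume_root_lim (R : realType) (s : 'I_3 -> R) : R :=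
  limn (volume_root s).

(* Main.v *)
Require Import Defs.
From mathcomp Require Import all_boot all_order all_algebra.
From mathcomp Require Import all_classical all_reals all_analysis.
From mathcomp Require Import measurable_realfun.
From mathcomp Require Import ring lra zify.

Set Implicit Arguments.
Unset Strict Implicit.
Unset Printing Implicit Defensive.

Import Order.TTheory GRing.Theory Num.Theory.
Import numFieldNormedType.Exports.

Local Open Scope classical_set_scope.
Local Open Scope ring_scope.

(** Write V_n for the volume of the polytope on the n-torus and z_n for
    (ln V_n) / (n^2 - 1), the logarithm of the volume root.  Everything follows
    from one comparison between a torus and its multiples: if N = k n <= n^4, then
    |z_n - z_N| <= C (ln n) / n  ([log_volume_root_step]).  Two sizes n <= m <= n^3
    are then compared through their common multiple n m, and larger ratios by
    passing from n to n^3, which shrinks the error by a factor 3/4; so (z_n) is a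
    Cauchy sequence with this same rate ([rate_of_multiples]), and exponentiating
    gives the claim ([exp_rate]).

    For the comparison, the N-torus is cut into k^2 cells, each a copy of the
    vertex set of the n-torus.  A rhombus spans at most two steps in each
    direction, so all its vertices outside the cell of its base point lie in the
    boundary, the first two rows and columns of a cell ([cell_step]).  Hence, for
    functions whose values on the boundary are the same in all cells up to an error
    of order 1/n, the Hessian on the N-torus agrees, up to an error of that order,
    with the Hessians of the k^2 restrictions regarded as functions on the n-torus
    ([hessian_glue]).  The boundary has at most 4 n points per cell.  Pinning its
    values to intervals of length 1/n costs, by the pigeonhole principle, a factor
    polynomial in n per boundary point ([vol_pigeonhole]), which is
    exp (O (n ln n)) per cell of n^2 coordinates: exactly the admitted error.
    Relaxing s by a term of order 1/n costs only a dilation.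

    - From n to N ([capped_volume_pow_le]): choose the pinned boundary values on the
      n-torus and glue k^2 independent functions with these boundary values.
    - From N to n ([capped_volume_le_pow]): the pinned boundary values obtained on
      the N-torus vary from cell to cell.  By the Brunn-Minkowski inequality the
      volume of the part of a convex body that is pinned to given values is a
      quasi-concave function of these values; here it is also invariant under
      translations by cells.  So it can only grow when the pinned values are
      replaced by the average of their k^2 translates, which is the same in all
      cells.

    The Brunn-Minkowski inequality is proved for convex sets in its multiplicative
    form ([brunn_minkowski]), by induction on the dimension from a one-dimensional
    Prekopa-Leindler inequality ([prekopa_leindler1]).

    The polytope of mean-zero functions is thin in the space of all functions, and
    the cell argument wants a full-dimensional body.  It is therefore replaced by
    the set of all functions with the same Hessian bounds and values in [-L, L].
    Since one-sided Hessian bounds on the torus force the oscillation to be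
    O (n^2) ([hessian_diameter]), for L of that order both volumes agree up to
    factors polynomial in n ([polytope_volume_bounds]), which disappear in the
    root. *)

(** * Lebesgue measure on tuples: changes of variables *)

Section lebesgue_tuple_theory.
Context (R : realType).
Local Notation RT := (measurableTypeR R).
Local Notation mu := (@lebesgue_measure R).

Definition box d (A : 'I_d -> set RT) : set (d.-tuple RT) :=
  [set t | forall i, A i (tnth t i)].

Lemma lebesgue_boxE d (A : 'I_d -> set RT) : (forall i, measurable (A i)) ->
  lebesgue_tuple R d (box A) = (\prod_(i < d) mu (A i))%E.
Proof. exact: lebesgue_tuple_box. Qed.

(** Boxes are stable under intersection and generate the product sigma-algebra,
    so a measure is determined by its values on them.  All changes of variables
    below are thereby reduced to boxes, where they are one-dimensional. *)
Lemma lebesgue_tuple_unique d (m : {measure set (d.-tuple RT) -> \bar R}) :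
  (forall A : 'I_d -> set RT, (forall i, measurable (A i)) ->
     m (box A) = (\prod_(i < d) mu (A i))%E) ->
  forall S, measurable S -> m S = lebesgue_tuple R d S.
Proof.
move=> mbox S mS.
pose G : set (set (d.-tuple RT)) :=
  [set X | exists2 A : 'I_d -> set RT, (forall i, measurable (A i)) & X = box A].
pose g (k : nat) : set (d.-tuple RT) := box (fun=> `]- k%:R, k%:R]%classic).
have mg k (i : 'I_d) : measurable (`]- k%:R, k%:R]%classic : set RT) by [].
apply/esym/(measure_unique G g) => //.
- apply/seteqP; split.
    apply: smallest_sub; first exact: smallest_sigma_algebra.
    move=> X; rewrite -bigcup_seq /= => -[i _ [A mA <-]].
    apply: sub_sigma_algebra; exists (fun j => if j == i then A else setT).
      by move=> j; case: ifP.
    rewrite setTI; apply/seteqP; split=> t /=.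
      by move=> At j; case: eqP => // ->.
    by move=> /(_ i); rewrite eqxx.
  apply: smallest_sub; first exact: sigma_algebra_measurable.
  by move=> _ [A mA ->]; exact: measurable_box.
- move=> _ _ [A mA ->] [B mB ->]; exists (fun i => A i `&` B i).
    by move=> i; exact: measurableI.
  apply/seteqP; split=> t /=; first by move=> [hA hB] i; split.
  by move=> h; split=> i; case: (h i).
- by move=> k; exists (fun=> `]- k%:R, k%:R]%classic).
- apply/seteqP; split=> // t _.
  have [k hk] : exists k : nat, forall i, `|tnth t i| < k%:R.
    exists (\max_(i < d) (Num.truncn `|tnth t i|).+1) => i.
    apply: (lt_le_trans (truncnS_gt _)).
    by rewrite ler_nat (leq_bigmax i).
  exists k => // i; have := hk i; rewrite ltr_norml => /andP[h1 h2] /=.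
  by rewrite in_itv /= h1 ltW.
- by move=> _ [A mA ->]; rewrite mbox// -lebesgue_boxE.
- move=> k; suff : (lebesgue_tuple R d (g k) < +oo)%E by []; rewrite lebesgue_boxE//.
  rewrite lebesgue_measure_itv /= lte_fin.
  rewrite -EFinB -[0%E]/(0%:E) -(fun_if EFin) prodEFin.
  exact: ltry.
Qed.

Definition tuple_reindex d (s : 'I_d -> 'I_d) (t : d.-tuple RT) : d.-tuple RT :=
  [tuple tnth t (s i) | i < d].

Lemma measurable_tuple_reindex d (s : 'I_d -> 'I_d) :
  measurable_fun setT (tuple_reindex s).
Proof.
apply/measurable_fun_tnthP => i.
rewrite (_ : _ \o _ = fun t : d.-tuple RT => tnth t (s i)); first exact: measurable_tnth.
by apply/funext => t /=; rewrite tnth_mktuple.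
Qed.

Lemma lebesgue_tuple_reindex d (s : 'I_d -> 'I_d) (S : set (d.-tuple RT)) :
  injective s -> measurable S ->
  lebesgue_tuple R d (tuple_reindex s @^-1` S) = lebesgue_tuple R d S.
Proof.
move=> s_inj mS.
have /= := @lebesgue_tuple_unique d (measure_function_pushforward__canonical__measure_function_Measure
     (lebesgue_tuple R d) (measurable_tuple_reindex s)) _ S mS.
apply=> A mA /=; rewrite /pushforward.
have [s' sK s'K] := injF_bij s_inj.
rewrite (_ : _ @^-1` _ = box (A \o s')); last first.
  apply/seteqP; split=> t /= h i.
    by have := h (s' i); rewrite tnth_mktuple s'K.
  by rewrite tnth_mktuple; have := h (s i); rewrite /= sK.
rewrite [LHS](lebesgue_boxE (A := A \o s')); last by move=> i; exact: mA.
rewrite (reindex s) /=; last by exists s' => // i _; rewrite ?sK ?s'K.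
by apply: eq_bigr => i _; rewrite sK.
Qed.

Lemma measurable_affine (a c : R) : measurable_fun setT (fun x : RT => a * x + c : RT).
Proof. by apply: measurable_funD => //; exact: measurable_funM. Qed.

Lemma lebesgue_measure_affine (a c : R) (A : set RT) : 0 < a -> measurable A ->
  (a%:E * mu ((fun x : RT => (a * x + c)%R : RT) @^-1` A) = mu A)%E.
Proof.
move=> a0 mA.
have /= := @lebesgue_measure_unique R
  (mscale (NngNum (ltW a0)) (measure_function_pushforward__canonical__measure_function_Measure
     mu (measurable_affine a c))) _ A mA.
move=> h; apply/esym/h => /= _ [[u v]] _ <-.
rewrite /mscale /= /pushforward.
rewrite (_ : _ @^-1` _ = `](u - c) / a, (v - c) / a]%classic); last first.
  apply/seteqP; split=> x /=; rewrite !in_itv /= ltr_pdivrMr// ler_pdivlMr//;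
  by rewrite ltrBlDr lerBrDr mulrC.
rewrite !lebesgue_measure_itv /= !lte_fin ltr_pM2r ?invr_gt0// ltrD2r.
case: ifP => _; rewrite ?mule0// -!EFinB -EFinM; congr (_%:E).
by field; rewrite gt_eqF.
Qed.

Definition tuple_affine d (a : R) (c : 'I_d -> R) (t : d.-tuple RT) : d.-tuple RT :=
  [tuple a * tnth t i + c i | i < d].

Lemma measurable_tuple_affine d a (c : 'I_d -> R) :
  measurable_fun setT (tuple_affine a c).
Proof.
apply/measurable_fun_tnthP => i.
rewrite (_ : _ \o _ = (fun x : RT => a * x + c i : RT) \o (fun t : d.-tuple RT => tnth t i)).
  by apply: measurableT_comp; [exact: measurable_affine|exact: measurable_tnth].
by apply/funext => t /=; rewrite tnth_mktuple.
Qed.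

Lemma lebesgue_tuple_affine d a (c : 'I_d -> R) (S : set (d.-tuple RT)) :
  0 < a -> measurable S ->
  ((a ^+ d)%:E * lebesgue_tuple R d (tuple_affine a c @^-1` S) =
   lebesgue_tuple R d S)%E.
Proof.
move=> a0 mS.
have ad0 : 0 <= a ^+ d by rewrite exprn_ge0// ltW.
have /= := @lebesgue_tuple_unique d
  (mscale (NngNum ad0) (measure_function_pushforward__canonical__measure_function_Measure
     (lebesgue_tuple R d) (measurable_tuple_affine a c))) _ S mS.
apply=> A mA; rewrite /mscale /= /pushforward.
pose A' i : set RT := (fun x : RT => a * x + c i : RT) @^-1` A i.
rewrite (_ : _ @^-1` _ = box A'); last first.
  apply/seteqP; split=> t /= h i.
    by have := h i; rewrite tnth_mktuple.
  by rewrite tnth_mktuple; exact: h.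
rewrite [X in (_ * X)%E](lebesgue_boxE (A := A')); last first.
  by move=> i; rewrite -[X in measurable X]setTI; exact: measurable_affine.
have -> : a ^+ d = \prod_(i < d) a by rewrite prodr_const card_ord.
rewrite -prodEFin -big_split /=.
by apply: eq_bigr => i _; rewrite lebesgue_measure_affine.
Qed.

Definition tuple_cat a b (p : a.-tuple RT * b.-tuple RT) : (a + b).-tuple RT :=
  [tuple of p.1 ++ p.2].

Lemma measurable_tuple_cat a b : measurable_fun setT (@tuple_cat a b).
Proof.
apply/measurable_fun_tnthP => i.
case: (split_ordP i) => j ->.
  rewrite (_ : _ \o _ = (fun t : a.-tuple RT => tnth t j) \o fst).
    by apply: measurableT_comp; [exact: measurable_tnth|exact: measurable_fst].
  by apply/funext => t /=; rewrite tnth_lshift.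
rewrite (_ : _ \o _ = (fun t : b.-tuple RT => tnth t j) \o snd).
  by apply: measurableT_comp; [exact: measurable_tnth|exact: measurable_snd].
by apply/funext => t /=; rewrite tnth_rshift.
Qed.

Lemma lebesgue_tuple_cat a b (S : set ((a + b).-tuple RT)) : measurable S ->
  ((lebesgue_tuple R a \x lebesgue_tuple R b) (@tuple_cat a b @^-1` S) =
   lebesgue_tuple R (a + b) S)%E.
Proof.
move=> mS.
have /= := @lebesgue_tuple_unique (a + b)
  (measure_function_pushforward__canonical__measure_function_Measure
   (lebesgue_tuple R a \x lebesgue_tuple R b)%E (@measurable_tuple_cat a b)) _ S mS.
apply=> A mA /=; rewrite /pushforward.
pose Al i := A (lshift b i); pose Ar i := A (rshift a i).
rewrite (_ : _ @^-1` _ = box Al `*` box Ar); last first.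
  apply/seteqP; split=> -[t u] /=.
    move=> h; split=> i.
      by have := h (lshift b i); rewrite tnth_lshift.
    by have := h (rshift a i); rewrite tnth_rshift.
  move=> [hl hr] i; case: (split_ordP i) => j ->.
    by rewrite tnth_lshift; exact: hl.
  by rewrite tnth_rshift; exact: hr.
have mAl i : measurable (Al i) by exact: mA.
have mAr i : measurable (Ar i) by exact: mA.
rewrite product_measure1E; [|exact: measurable_box..].
by rewrite [X in (X * _)%E](lebesgue_boxE mAl) [X in (_ * X)%E](lebesgue_boxE mAr) big_split_ord.
Qed.

End lebesgue_tuple_theory.

(** * The one-dimensional Prekopa-Leindler inequality *)

Section prekopa_leindler.
Context (R : realType).
Local Notation RT := (measurableTypeR R).
Local Notation mu := (@lebesgue_measure R).

Lemma weighted_am_gm (l a b : R) : 0 < l -> l < 1 -> 0 < a -> 0 < b ->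
  a `^ (1 - l) * b `^ l <= (1 - l) * a + l * b.
Proof.
move=> l0 l1 a0 b0.
have := @concave_ln R (Itv01 (ltW l0) (ltW l1)) b a b0 a0.
rewrite !convRE /= /unstable.onem => h.
have c0 : 0 < l * b + (1 - l) * a by rewrite addr_gt0// mulr_gt0// subr_gt0.
rewrite -ler_ln ?posrE ?mulr_gt0 ?powR_gt0//; last by rewrite addrC.
by rewrite lnM ?posrE ?powR_gt0// !ln_powR addrC [X in _ <= ln X]addrC.
Qed.

Lemma lebesgue_interval_le (I : set RT) (M : R) : measurable I ->
  I !=set0 -> (forall x, I x -> `|x| <= M) ->
  (mu I <= (sup I - inf I)%:E)%E.
Proof.
move=> mI [x0 Ix0] IM.
have hs : has_ubound I.
  by exists M => x /IM; rewrite ler_norml => /andP[].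
have hi : has_lbound I.
  by exists (- M) => x /IM; rewrite ler_norml => /andP[].
have sub : I `<=` `[inf I, sup I]%classic.
  move=> x Ix /=; rewrite in_itv /=; apply/andP; split.
    exact: ge_inf hi _ Ix.
  exact: ub_le_sup hs _ Ix.
apply: (@le_trans _ _ (mu `[inf I, sup I]%classic)).
  by apply: le_measure => //; rewrite inE.
rewrite lebesgue_measure_itv /= lte_fin; case: ifP => //.
have := sub _ Ix0; rewrite /= in_itv /= lee_fin subr_ge0 => /andP[h1 h2] _.
exact: le_trans h1 h2.
Qed.

(** The one-dimensional Brunn-Minkowski inequality for intervals: the mixture
    contains the whole open interval between the mixed infima and the mixed
    suprema. *)
Lemma interval_mix_measure (I J K : set RT) (l M : R) :
  0 < l -> l < 1 -> I !=set0 -> J !=set0 ->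
  is_interval I -> is_interval J ->
  (forall x, I x -> `|x| <= M) -> (forall x, J x -> `|x| <= M) ->
  measurable I -> measurable J -> measurable K ->
  (forall x y, I x -> J y -> K ((1 - l) * x + l * y)) ->
  ((1 - l)%:E * mu I + l%:E * mu J <= mu K)%E.
Proof.
move=> l0 l1 I0 J0 iI iJ IM JM mI mJ mK IJK.
have l1' : 0 < 1 - l by rewrite subr_gt0.
pose u := (1 - l) * inf I + l * inf J.
pose v := (1 - l) * sup I + l * sup J.
have sub : `]u, v[%classic `<=` K.
  move=> z; rewrite /= in_itv /= => /andP[uz zv].
  have [x1 [Ix1 [y1 [Jy1 h1]]]] : exists x1, I x1 /\ exists y1, J y1 /\
      z < (1 - l) * x1 + l * y1.
    have e0 : 0 < v - z by rewrite subr_gt0.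
    have [|x1 Ix1 hx1] := @sup_gt _ I (sup I - (v - z)) I0; first by rewrite ltrBlDr ltrDl.
    have [|y1 Jy1 hy1] := @sup_gt _ J (sup J - (v - z)) J0; first by rewrite ltrBlDr ltrDl.
    exists x1; split => //; exists y1; split => //.
    have : (1 - l) * (sup I - (v - z)) + l * (sup J - (v - z)) < (1 - l) * x1 + l * y1.
      by rewrite ltrD// ltr_pM2l.
    by apply: le_lt_trans; rewrite /v; lra.
  have [x0 [Ix0 [y0 [Jy0 h0]]]] : exists x2, I x2 /\ exists y2, J y2 /\
      (1 - l) * x2 + l * y2 < z.
    have e0 : 0 < z - u by rewrite subr_gt0.
    have [|x2 Ix2 hx2] := @inf_lt _ I (inf I + (z - u)) I0; first by rewrite ltrDl.
    have [|y2 Jy2 hy2] := @inf_lt _ J (inf J + (z - u)) J0; first by rewrite ltrDl.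
    exists x2; split => //; exists y2; split => //.
    have : (1 - l) * x2 + l * y2 < (1 - l) * (inf I + (z - u)) + l * (inf J + (z - u)).
      by rewrite ltrD// ltr_pM2l.
    by move=> /lt_le_trans; apply; rewrite /u; lra.
  set w1 := (1 - l) * x1 + l * y1 in h1; set w0 := (1 - l) * x0 + l * y0 in h0.
  pose s := (z - w0) / (w1 - w0).
  have w01 : 0 < w1 - w0 by rewrite subr_gt0; exact: lt_trans h1.
  have s0 : 0 <= s by rewrite divr_ge0 ?ltW// subr_gt0.
  have s1 : s <= 1 by rewrite ler_pdivrMr// mul1r lerD2r ltW.
  have conv (A : set R) a b : is_interval A -> A a -> A b -> A ((1 - s) * a + s * b).
    move=> iA Aa Ab; have [ab|ba] := leP a b.
      apply: (iA _ _ Aa Ab); apply/andP; split; nra.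
    apply: (iA _ _ Ab Aa); apply/andP; split; nra.
  have -> : z = (1 - l) * ((1 - s) * x0 + s * x1) + l * ((1 - s) * y0 + s * y1).
    have -> : z = w0 + s * (w1 - w0) by rewrite /s divfK ?gt_eqF// addrC subrK.
    by rewrite /w0 /w1; ring.
  by apply: IJK; exact: conv.
have muI := lebesgue_interval_le mI I0 IM.
have muJ := lebesgue_interval_le mJ J0 JM.
apply: (@le_trans _ _ (v - u)%:E).
  have -> : v - u = (1 - l) * (sup I - inf I) + l * (sup J - inf J).
    by rewrite /u /v; ring.
  rewrite [leRHS]EFinD !EFinM leeD// lee_wpmul2l// lee_fin ltW//.
apply: (@le_trans _ _ (mu `]u, v[%classic)).
  rewrite lebesgue_measure_itv /= lte_fin; case: ltP => //.
  by rewrite lee_fin subr_le0.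
by apply: le_measure => //; rewrite inE.
Qed.

Lemma sections_swap d1 d2 (T1 : measurableType d1) (T2 : measurableType d2)
  (m1 : {sigma_finite_measure set T1 -> \bar R})
  (m2 : {sigma_finite_measure set T2 -> \bar R}) (A : set (T1 * T2)) : measurable A ->
  (\int[m1]_x m2 (xsection A x) = \int[m2]_y m1 (ysection A y))%E.
Proof.
move=> mA; have := indic_fubini_tonelli m1 m2 mA.
by rewrite (indic_fubini_tonelli_FE m2 mA) (indic_fubini_tonelli_GE m1 mA).
Qed.

(** The first coordinate is the height, measured in units of [c]. *)
Definition hypograph (f : RT -> R) (c : R) : set (RT * RT) :=
  [set p : RT * RT | 0 < p.1 /\ p.1 * c < f p.2].

Lemma measurable_hypograph f c : measurable_fun setT f -> measurable (hypograph f c).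
Proof.
move=> mf.
rewrite (_ : hypograph f c = (fun p : RT * RT => 0 < p.1) @^-1` [set true] `&`
   (fun p : RT * RT => p.1 * c < f p.2) @^-1` [set true])//.
apply: measurableI; rewrite -[X in measurable X]setTI.
  by apply: measurable_fun_ltr => //; exact: measurable_fst.
apply: measurable_fun_ltr => //.
  by apply: measurable_funM => //; exact: measurable_fst.
by apply: measurableT_comp => //; exact: measurable_snd.
Qed.

Definition superlevel (f : RT -> R) (c t : R) : set RT :=
  [set x | 0 < t /\ t * c < f x].

Lemma xsection_hypograph f c t : xsection (hypograph f c) t = superlevel f c t.
Proof. by apply/seteqP; split=> x; rewrite /xsection /= inE. Qed.

(** Tonelli's theorem on the hypograph: its vertical sections are the intervals
    from 0 to [f x / c], its horizontal sections are the superlevel sets. *)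
Lemma layer_cake (f : RT -> R) (c : R) : 0 < c ->
  measurable_fun setT f -> (forall x, 0 <= f x) ->
  (\int[mu]_t mu (superlevel f c t) =
   \int[mu]_x (f x / c)%:E)%E.
Proof.
move=> c0 mf f0.
under eq_integral do rewrite -xsection_hypograph.
rewrite (sections_swap _ _ (measurable_hypograph c mf)).
apply: eq_integral => x _.
have -> : ysection (hypograph f c) x = `]0, f x / c[%classic.
  apply/seteqP; split=> t; rewrite /ysection /= inE /hypograph /= in_itv /= ltr_pdivlMr//.
    by move=> [-> ->].
  by move=> /andP[].
rewrite [LHS]lebesgue_measure_itv /= lte_fin; case: ltP => h; first by rewrite -EFinB subr0.
by congr (_%:E); apply/eqP; rewrite eq_le h divr_ge0// ltW.
Qed.

(** Let [p] and [q] be the suprema of [f] and [g].  For 0 < t < 1 the sets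
    {f > t p} and {g > t q} are nonempty intervals, and their mixture lies in
    {h > t P} with P = p^(1-l) q^l.  Integrating the one-dimensional
    Brunn-Minkowski inequality over t bounds (1-l) (int f)/p + l (int g)/q by
    (int h)/P, and the weighted inequality of arithmetic and geometric means
    concludes.  The normalisation by the suprema is what makes both superlevel
    sets nonempty at the same heights. *)
Lemma prekopa_leindler1 (f g h : RT -> R) (l M B : R) :
  0 < l -> l < 1 ->
  measurable_fun setT f -> measurable_fun setT g -> measurable_fun setT h ->
  (forall x, 0 <= f x) -> (forall x, 0 <= g x) -> (forall x, 0 <= h x) ->
  (forall x, f x <= B) -> (forall x, g x <= B) ->
  (forall x, 0 < f x -> `|x| <= M) -> (forall x, 0 < g x -> `|x| <= M) ->
  (forall t : R, 0 <= t -> is_interval [set x | t < f x]) ->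
  (forall t : R, 0 <= t -> is_interval [set x | t < g x]) ->
  (forall x y, f x `^ (1 - l) * g y `^ l <= h ((1 - l) * x + l * y)) ->
  forall a b : R, 0 <= a -> 0 <= b -> (a%:E <= \int[mu]_x (f x)%:E)%E ->
    (b%:E <= \int[mu]_x (g x)%:E)%E ->
  ((a `^ (1 - l) * b `^ l)%:E <= \int[mu]_x (h x)%:E)%E.
Proof.
move=> l0 l1 mf mg mh f0 g0 h0 fB gB fM gM fI gI fgh a b.
have l1' : 0 < 1 - l by rewrite subr_gt0.
have inth : (0 <= \int[mu]_x (h x)%:E)%E by apply: integral_ge0 => x _; rewrite lee_fin.
rewrite le_eqVlt => /predU1P[<-|a0]; first by rewrite powR0 ?gt_eqF// mul0r.
rewrite le_eqVlt => /predU1P[<-|b0]; first by rewrite [0 `^ l]powR0 ?gt_eqF// mulr0.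
move=> af bg.
have sup_pos (F : RT -> R) (c : R) : (forall x, 0 <= F x) -> (forall x, F x <= B) ->
    0 < c -> (c%:E <= \int[mu]_x (F x)%:E)%E ->
    [/\ 0 < sup (range F), forall x, F x <= sup (range F) &
        forall t, t < 1 -> exists x, t * sup (range F) < F x].
  move=> F0 FB c0 cF.
  have ub x : F x <= sup (range F).
    by apply: ub_le_sup; [exists B => _ [y _ <-]|exists x].
  have p0 : 0 < sup (range F).
    rewrite lt_neqAle (le_trans (F0 0) (ub 0)) andbT eq_sym; apply/negP => /eqP s0.
    move: cF; rewrite integral0_eq; first by rewrite lee_fin leNgt c0.
    by move=> x _; congr _%:E; apply/eqP; rewrite eq_le F0 -s0 ub.
  split=> // t t1.
  have ne : range F !=set0 by exists (F 0), 0.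
  have lts : t * sup (range F) < sup (range F) by rewrite gtr_pMl.
  by have [_ [x _ <-] hx] := sup_gt ne lts; exists x.
have [p0 fp fsup] := sup_pos _ _ f0 fB a0 af.
have [q0 gq gsup] := sup_pos _ _ g0 gB b0 bg.
set p := sup (range f) in p0 fp fsup; set q := sup (range g) in q0 gq gsup.
pose P := p `^ (1 - l) * q `^ l.
have P0 : 0 < P by rewrite mulr_gt0// powR_gt0.
pose L (F : RT -> R) (c : R) (t : RT) := mu (superlevel F c t).
have mL (F : RT -> R) (c : R) : measurable_fun setT F -> measurable_fun setT (L F c).
  move=> mF; rewrite /L.
  rewrite (_ : (fun t => _) = mu \o xsection (hypograph F c)).
    by apply: measurable_fun_xsection; exact: measurable_hypograph.
  by apply/funext => t /=; rewrite xsection_hypograph.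
have mset (F : RT -> R) (c t : R) : measurable_fun setT F -> measurable (superlevel F c t).
  move=> mF; rewrite -xsection_hypograph.
  by apply: measurable_xsection; exact: measurable_hypograph.
have key t : ((1 - l)%:E * L f p t + l%:E * L g q t <= L h P t)%E.
  rewrite /L; have [t0|t0] := leP t 0.
    have E (F : RT -> R) c : superlevel F c t = set0.
      by apply/seteqP; split => // x [] ; rewrite ltNge t0.
    by rewrite !E measure0 !mule0 adde0.
  have [t1|t1] := leP 1 t.
    have E (F : RT -> R) c : (forall x, F x <= c) -> 0 < c -> superlevel F c t = set0.
      move=> Fc c0; apply/seteqP; split => // x [_]; rewrite ltNge (le_trans (Fc x))//.
      by rewrite ler_peMl// ltW.
    by rewrite (E f p)// (E g q)// measure0 !mule0 adde0.
  have E (F : RT -> R) c : superlevel F c t = [set x | t * c < F x].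
    by apply/seteqP; split => // x [].
  apply: (@interval_mix_measure _ _ _ _ M) => //; try exact: mset.
  - by have [x hx] := fsup _ t1; exists x.
  - by have [x hx] := gsup _ t1; exists x.
  - by rewrite E; apply: fI; rewrite mulr_ge0// ltW.
  - by rewrite E; apply: gI; rewrite mulr_ge0// ltW.
  - by move=> x [_ hx]; apply: fM; apply: le_lt_trans hx; rewrite mulr_ge0// ltW.
  - by move=> x [_ hx]; apply: gM; apply: le_lt_trans hx; rewrite mulr_ge0// ltW.
  - move=> x y [_ hx] [_ hy]; split => //.
    apply: lt_le_trans (fgh x y).
    have -> : t * P = (t * p) `^ (1 - l) * (t * q) `^ l.
      rewrite !powRM ?ltW// /P mulrACA -powRD ?subrK ?powRr1 ?ltW//.
      by rewrite (gt_eqF t0) implybT.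
    apply: ltr_pM; rewrite ?powR_ge0//; apply: gt0_ltr_powR => //;
    by rewrite nnegrE; first [exact: f0|exact: g0|rewrite mulr_ge0 ?ltW].
have intL (F : RT -> R) (c : R) : 0 < c -> measurable_fun setT F -> (forall x, 0 <= F x) ->
   (\int[mu]_t L F c t = (c^-1)%:E * \int[mu]_x (F x)%:E)%E.
  move=> c0 mF F0; rewrite layer_cake// -ge0_integralZl//; last first.
  - by rewrite lee_fin invr_ge0 ltW.
  - by move=> x _; rewrite lee_fin.
  - exact/measurable_EFinP.
  by apply: eq_integral => x _; rewrite -EFinM mulrC.
have L0 (F : RT -> R) (c : R) (t : RT) : (0 <= L F c t)%E by exact: measure_ge0.
have : (\int[mu]_t ((1 - l)%:E * L f p t + l%:E * L g q t) <= \int[mu]_t L h P t)%E.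
  apply: ge0_le_integral => //.
  - by move=> t _; rewrite adde_ge0// mule_ge0// lee_fin ltW.
  - by apply: emeasurable_funD; apply: measurable_funeM; exact: mL.
  - exact: mL.
rewrite ge0_integralD//; last 4 first.
- by move=> t _; rewrite mule_ge0// lee_fin ltW.
- by apply: measurable_funeM; exact: mL.
- by move=> t _; rewrite mule_ge0// lee_fin ltW.
- by apply: measurable_funeM; exact: mL.
rewrite !ge0_integralZl//; try exact: mL; try by rewrite lee_fin ltW.
rewrite !intL// => H.
have : (((a / p) `^ (1 - l) * (b / q) `^ l)%:E <= (P^-1)%:E * \int[mu]_x (h x)%:E)%E.
  apply: le_trans H; apply: (@le_trans _ _ ((1 - l) * (a / p) + l * (b / q))%:E).
    by rewrite lee_fin weighted_am_gm// divr_gt0.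
  have scale (c d k : R) (u : \bar R) : 0 < c -> 0 < k -> (d%:E <= u)%E ->
      ((k * (d / c))%:E <= k%:E * ((c^-1)%:E * u))%E.
    move=> c0 k0 du; rewrite EFinM lee_pmul2l ?lte_fin// mulrC EFinM.
    by rewrite lee_pmul2l// lte_fin invr_gt0.
  by rewrite [leLHS]EFinD leeD// scale.
have -> : (a / p) `^ (1 - l) * (b / q) `^ l = P^-1 * (a `^ (1 - l) * b `^ l).
  rewrite !powRM ?invr_ge0 ?ltW// /P invfM -!powRN -!powR_inv1 ?ltW// -!powRrM !mulN1r.
  by ring.
by rewrite EFinM lee_pmul2l// lte_fin invr_gt0.
Qed.

End prekopa_leindler.

(** * The Brunn-Minkowski inequality for convex sets *)

Section brunn_minkowski.
Context (R : realType).
Local Notation RT := (measurableTypeR R).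
Local Notation mu := (@lebesgue_measure R).

Definition slice d (A : set (d.+1.-tuple RT)) (x : RT) : set (d.-tuple RT) :=
  [set t | A (cons_pair (x, t))].

Lemma slice_xsection d (A : set (d.+1.-tuple RT)) x :
  slice A x = xsection (@cons_pair R d @^-1` A) x.
Proof. by apply/seteqP; split=> t; rewrite /xsection /slice /= inE. Qed.

Lemma measurable_cons_preimage d (A : set (d.+1.-tuple RT)) : measurable A ->
  measurable (@cons_pair R d @^-1` A).
Proof. by move=> mA; rewrite -[X in measurable X]setTI; exact: measurable_cons_pair. Qed.

Lemma measurable_slice d (A : set (d.+1.-tuple RT)) x :
  measurable A -> measurable (slice A x).
Proof.
by move=> mA; rewrite slice_xsection; apply: measurable_xsection; exact: measurable_cons_preimage.
Qed.

Lemma measurable_fun_slice d (A : set (d.+1.-tuple RT)) : measurable A ->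
  measurable_fun setT (fun x : RT => lebesgue_tuple R d (slice A x)).
Proof.
move=> mA; rewrite (_ : (fun x => _) = lebesgue_tuple R d \o xsection (@cons_pair R d @^-1` A)).
  by apply: measurable_fun_xsection; exact: measurable_cons_preimage.
by apply/funext => x /=; rewrite slice_xsection.
Qed.

Lemma lebesgue_tupleS d (A : set (d.+1.-tuple RT)) :
  (lebesgue_tuple R d.+1 A = \int[mu]_x lebesgue_tuple R d (slice A x))%E.
Proof.
rewrite /= /lebesgue_cons /pushforward /product_measure1 /=.
by apply: eq_integral => x _; rewrite slice_xsection.
Qed.

Definition bounded_tuples d (M : R) (A : set (d.-tuple RT)) :=
  forall t, A t -> forall i, `|tnth t i| <= M.

Lemma lebesgue_tuple_bounded d (M : R) (A : set (d.-tuple RT)) : 0 <= M ->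
  measurable A -> bounded_tuples M A ->
  (lebesgue_tuple R d A <= ((2 * M) ^+ d)%:E)%E.
Proof.
move=> M0 mA AM.
pose I (i : 'I_d) : set RT := `[- M, M]%classic.
apply: (@le_trans _ _ (lebesgue_tuple R d (box I))).
  apply: le_measure; rewrite ?inE//; first by apply: measurable_box => i; exact: measurable_itv.
  by move=> t At i; rewrite /I /= in_itv /= -ler_norml; exact: AM.
rewrite [leLHS]lebesgue_boxE; last by move=> i; exact: measurable_itv.
rewrite (eq_bigr (fun=> (2 * M)%:E)); last first.
  move=> i _; rewrite lebesgue_measure_itv /= lte_fin; case: ltP => h.
    by rewrite -EFinB; congr (_%:E); ring.
  by congr (_%:E); lra.
by rewrite prodEFin prodr_const card_ord.
Qed.

Definition tmix d (l : R) (x y : d.-tuple RT) : d.-tuple RT :=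
  [tuple (1 - l) * tnth x i + l * tnth y i | i < d].

Definition tconvex d (A : set (d.-tuple RT)) :=
  forall l, 0 < l -> l < 1 -> forall x y, A x -> A y -> A (tmix l x y).

Lemma tmix_cons d l (x y : RT) (t u : d.-tuple RT) :
  tmix l (cons_pair (x, t)) (cons_pair (y, u)) =
  cons_pair ((1 - l) * x + l * y, tmix l t u).
Proof.
apply: eq_from_tnth => i; rewrite tnth_mktuple.
by case: (unliftP ord0 i) => [j ->|->]; rewrite ?tnthS ?tnth_mktuple.
Qed.

Lemma tconvex_slice d (A : set (d.+1.-tuple RT)) x : tconvex A -> tconvex (slice A x).
Proof.
move=> cA l l0 l1 t u At Au; have := cA l l0 l1 _ _ At Au.
by rewrite tmix_cons /slice /=; congr (A (cons_pair (_, _))); ring.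
Qed.

Lemma bounded_slice d M (A : set (d.+1.-tuple RT)) x :
  bounded_tuples M A -> bounded_tuples M (slice A x).
Proof. by move=> AM t At i; have := AM _ At (lift ord0 i); rewrite tnthS. Qed.

(** Induction on the dimension: the volumes of the slices of [A], [B] and [C] by
    the first coordinate satisfy the hypotheses of [prekopa_leindler1].  The
    induction hypothesis is used twice: for slices of [A], [B] and [C] it gives the
    multiplicative inequality, and for slices of one convex set it shows that the
    superlevel sets of the volume of the slice are intervals. *)
Lemma brunn_minkowski d (l M : R) (A B C : set (d.-tuple RT)) :
  0 < l -> l < 1 -> 0 <= M ->
  measurable A -> measurable B -> measurable C ->
  bounded_tuples M A -> bounded_tuples M B -> bounded_tuples M C ->
  tconvex A -> tconvex B ->
  (forall x y, A x -> B y -> C (tmix l x y)) ->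
  fine (lebesgue_tuple R d A) `^ (1 - l) * fine (lebesgue_tuple R d B) `^ l
    <= fine (lebesgue_tuple R d C).
Proof.
move=> + + M0.
elim: d l A B C => [|d IHd] l A B C l0 l1 mA mB mC AM BM CM cA cB ABC.
  have E0 (D : set (0.-tuple RT)) : lebesgue_tuple R 0 D = (([tuple] \in D)%:R%:E)%E.
    exact: diracE.
  have l1' : 0 < 1 - l by rewrite subr_gt0.
  rewrite !E0 /=.
  have [/set_mem At|] := boolP ([tuple] \in A); last by rewrite powR0 ?mul0r ?gt_eqF.
  have [/set_mem Bt|] := boolP ([tuple] \in B); last by rewrite mulrC powR0 ?mul0r ?gt_eqF.
  rewrite mem_set /= ?powR1 ?mulr1//.
  by have := ABC _ _ At Bt; rewrite tuple0.
have fin (D : set (d.-tuple RT)) : measurable D -> bounded_tuples M D ->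
    lebesgue_tuple R d D \is a fin_num.
  move=> mD DM; rewrite ge0_fin_numE ?measure_ge0//.
  exact: le_lt_trans (lebesgue_tuple_bounded M0 mD DM) (ltry _).
pose F (D : set (d.+1.-tuple RT)) (x : RT) := fine (lebesgue_tuple R d (slice D x)).
have FE D : measurable D -> bounded_tuples M D ->
   (lebesgue_tuple R d.+1 D = \int[mu]_x (F D x)%:E)%E.
  move=> mD DM; rewrite lebesgue_tupleS; apply: eq_integral => x _.
  by rewrite fineK// fin//; [exact: measurable_slice|exact: bounded_slice].
have mF D : measurable D -> measurable_fun setT (F D).
  move=> mD; apply: measurableT_comp; last exact: measurable_fun_slice.
  exact: fine_measurable.
have F0 D x : 0 <= F D x by rewrite fine_ge0.
have FB D x : measurable D -> bounded_tuples M D -> F D x <= (2 * M) ^+ d.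
  move=> mD DM; rewrite -lee_fin fineK ?fin//; try exact: measurable_slice; try exact: bounded_slice.
  apply: lebesgue_tuple_bounded => //; [exact: measurable_slice|exact: bounded_slice].
have FM D x : bounded_tuples M D -> 0 < F D x -> `|x| <= M.
  move=> DM; apply: contraTT => hx; rewrite /F (_ : slice D x = set0) ?measure0 ?ltxx//.
  apply/seteqP; split=> // t Dt; have := DM _ Dt ord0.
  by rewrite /= => h; case/negP: hx.
have FI D t : measurable D -> bounded_tuples M D -> tconvex D -> 0 <= t ->
    is_interval [set x | t < F D x].
  move=> mD DM cD t0 x y /= tx ty z /andP[xz zy].
  have [->//|zx] := eqVneq z x; have [->//|zy'] := eqVneq z y.
  have xz' : x < z by rewrite lt_neqAle eq_sym zx.
  have zy'' : z < y by rewrite lt_neqAle zy'.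
  pose k := (z - x) / (y - x).
  have yx : 0 < y - x by rewrite subr_gt0 (lt_trans xz').
  have k0 : 0 < k by rewrite divr_gt0// subr_gt0.
  have k1 : k < 1 by rewrite ltr_pdivrMr// mul1r ltrD2r.
  have yxE : y - x != 0 by rewrite gt_eqF.
  have zE : z = (1 - k) * x + k * y.
    have -> : z = x + k * (y - x) by rewrite /k divfK// addrC subrK.
    by ring.
  have k1' : 0 < 1 - k by rewrite subr_gt0.
  have := IHd k (slice D x) (slice D y) (slice D z) k0 k1
    (measurable_slice x mD) (measurable_slice y mD) (measurable_slice z mD)
    (bounded_slice (x := x) DM) (bounded_slice (x := y) DM) (bounded_slice (x := z) DM)
    (tconvex_slice cD) (tconvex_slice cD).
  have cmix u v : slice D x u -> slice D y v -> slice D z (tmix k u v).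
    by move=> Du Dv; have := cD _ k0 k1 _ _ Du Dv; rewrite tmix_cons zE.
  move=> /(_ cmix); apply: lt_le_trans; rewrite -/(F D x) -/(F D y).
  have -> : t = t `^ (1 - k) * t `^ k.
    by rewrite -powRD ?subrK ?powRr1// oner_eq0.
  by apply: ltr_pM; rewrite ?powR_ge0//; apply: gt0_ltr_powR => //;
    rewrite nnegrE ltW// (le_lt_trans t0).
have Cfin : lebesgue_tuple R d.+1 C \is a fin_num.
  rewrite ge0_fin_numE ?measure_ge0//.
  exact: le_lt_trans (lebesgue_tuple_bounded M0 mC CM) (ltry _).
have Afin : lebesgue_tuple R d.+1 A \is a fin_num.
  rewrite ge0_fin_numE ?measure_ge0//.
  exact: le_lt_trans (lebesgue_tuple_bounded M0 mA AM) (ltry _).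
have Bfin : lebesgue_tuple R d.+1 B \is a fin_num.
  rewrite ge0_fin_numE ?measure_ge0//.
  exact: le_lt_trans (lebesgue_tuple_bounded M0 mB BM) (ltry _).
rewrite -lee_fin (fineK Cfin) (FE C)//.
apply: (@prekopa_leindler1 R (F A) (F B) (F C) l M ((2 * M) ^+ d)) => //.
- exact: mF.
- exact: mF.
- exact: mF.
- by move=> x; exact: FB.
- by move=> x; exact: FB.
- by move=> x; exact: FM.
- by move=> x; exact: FM.
- by move=> t; exact: FI.
- by move=> t; exact: FI.
- move=> x y.
  apply: (IHd l (slice A x) (slice B y)) => //; try exact: measurable_slice;
    try exact: bounded_slice; try exact: tconvex_slice.
  by move=> u v Au Bv; have := ABC _ _ Au Bv; rewrite tmix_cons.
- by rewrite fine_ge0.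
- by rewrite fine_ge0.
- by rewrite fineK// FE.
- by rewrite fineK// FE.
Qed.

End brunn_minkowski.

(** * Volumes of sets of functions on a finite type *)

Lemma ltn_block i j m d : (i < m)%N -> (j < d)%N -> (i * d + j < m * d)%N.
Proof.
move=> im jd; apply: (@leq_trans (i.+1 * d)%N); last by rewrite leq_mul2r im orbT.
by rewrite mulSn addnC ltn_add2r.
Qed.

Section function_volume.
Context (R : realType).
Local Notation RT := (measurableTypeR R).

(** Coordinates are addressed by natural numbers, so that blocks of coordinates
    can be described by arithmetic; the default value is never read when [p] is a
    [numbering] of length [d]. *)
Definition coords (T : Type) d (p : T -> nat) (t : d.-tuple RT) : T -> R :=
  fun x => nth 0 t (p x).

Definition coordset (T : Type) d (p : T -> nat) (S : set (T -> R)) : set (d.-tuple RT) :=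
  [set t | S (coords p t)].
Arguments coordset {T} d p S.

Definition numbering (T : finType) d (p : T -> nat) :=
  [/\ injective p, forall x, (p x < d)%N & #|T| = d].
Arguments numbering {T} d p.

Definition vol (T : Type) d (p : T -> nat) (S : set (T -> R)) : R :=
  fine (lebesgue_tuple R d (coordset d p S)).
Arguments vol {T} d p S.

Definition fmeasurable (T : Type) d (p : T -> nat) (S : set (T -> R)) :=
  measurable (coordset d p S).
Arguments fmeasurable {T} d p S.

Definition meval (T : Type) d (p : T -> nat) (u : (T -> R) -> R) :=
  measurable_fun [set: d.-tuple RT] (fun t => u (coords p t)).
Arguments meval {T} d p u.

Lemma measurable_nth d (i : nat) :
  measurable_fun [set: d.-tuple RT] (fun t => nth 0 t i : RT).
Proof.
have [id|di] := ltnP i d.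
  rewrite (_ : (fun t => _) = fun t : d.-tuple RT => tnth t (Ordinal id)).
    exact: measurable_tnth.
  by apply/funext => t; rewrite (tnth_nth 0).
rewrite (_ : (fun t => _) = cst 0); first exact: measurable_cst.
by apply/funext => t /=; rewrite nth_default// size_tuple.
Qed.

Section measurability.
Context (T : Type) (d : nat) (p : T -> nat).

Lemma meval_pt x : meval d p (fun g => g x).
Proof. exact: measurable_nth. Qed.

Lemma mevalD u v : meval d p u -> meval d p v -> meval d p (fun g => u g + v g).
Proof. exact: measurable_funD. Qed.

Lemma mevalB u v : meval d p u -> meval d p v -> meval d p (fun g => u g - v g).
Proof. exact: measurable_funB. Qed.

Lemma fmeasurable_le u c : meval d p u -> fmeasurable d p [set g | u g <= c].
Proof.
move=> mu; rewrite /fmeasurable /coordset.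
rewrite (_ : mkset _ = (fun t : d.-tuple RT => u (coords p t)) @^-1` `]-oo, c]%classic).
  by rewrite -[X in measurable X]setTI; apply: mu.
by apply/seteqP; split=> t; rewrite /= in_itv.
Qed.

Lemma fmeasurable_norm u c : meval d p u -> fmeasurable d p [set g | `|u g| <= c].
Proof.
move=> mu; apply: (fmeasurable_le (u := fun g => `|u g|)).
exact: measurableT_comp mu.
Qed.

Lemma fmeasurableI A B : fmeasurable d p A -> fmeasurable d p B -> fmeasurable d p (A `&` B).
Proof. exact: measurableI. Qed.

Lemma fmeasurable_forall (I : finType) (A : I -> set (T -> R)) :
  (forall i, fmeasurable d p (A i)) -> fmeasurable d p [set g | forall i, A i g].
Proof.
move=> mA; rewrite /fmeasurable /coordset.
rewrite (_ : mkset _ = \bigcap_(i in [set: I]) coordset d p (A i)).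
  by apply: fin_bigcap_measurable => // i _; exact: mA.
by apply/seteqP; split=> t /= h i; [move=> _|]; exact: h.
Qed.

End measurability.

Definition fbounded (T : Type) (M : R) (A : set (T -> R)) :=
  forall g, A g -> forall x, `|g x| <= M.

Definition fmix (T : Type) (l : R) (g h : T -> R) : T -> R :=
  fun x => (1 - l) * g x + l * h x.

Definition fconvex (T : Type) (A : set (T -> R)) :=
  forall l, 0 < l -> l < 1 -> forall g h, A g -> A h -> A (fmix l g h).

Definition near_center (T : Type) (bd : pred T) (eta : R) (c : T -> R) : set (T -> R) :=
  [set g | forall x, bd x -> `|g x - c x| <= eta].

Lemma fmeasurable_near_center (T : finType) (bd : pred T) eta c d (p : T -> nat) :
  fmeasurable d p (near_center bd eta c).
Proof.
apply: (@fmeasurable_forall _ d p _ (fun x => [set g : T -> R | bd x -> `|g x - c x| <= eta])) => x.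
case: (boolP (bd x)) => bx.
  rewrite (_ : mkset _ = [set g | `|g x - c x| <= eta]).
    apply: (@fmeasurable_norm _ d p (fun g : T -> R => g x - c x)).
    by apply: (@mevalB _ d p); [exact: meval_pt|exact: measurable_cst].
  by apply/seteqP; split=> g /= h; [exact: h|move=> _; exact: h].
rewrite (_ : mkset _ = setT); first exact: measurableT.
by apply/seteqP; split.
Qed.

Lemma measure_big_le d (X : measurableType d) (m : {measure set X -> \bar R}) (I : Type)
    (r : seq I) (A : I -> set X) : (forall i, measurable (A i)) ->
  (m (\big[setU/set0]_(i <- r) A i) <= \sum_(i <- r) m (A i))%E.
Proof.
move=> mA; elim: r => [|i r IHr]; first by rewrite !big_nil measure0.
have mr : measurable (\big[setU/set0]_(j <- r) A j).
  by apply: bigsetU_measurable => j _; exact: mA.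
rewrite !big_cons; apply: (le_trans (measureU2 _ (mA i) mr)).
by rewrite leeD2l.
Qed.

Section finite_index.
Context (T : finType) (d : nat) (p : T -> nat) (pP : numbering d p).

Lemma numbering_ex (i : 'I_d) : exists x, p x = i.
Proof.
have [p_inj pd cT] := pP.
pose q x : 'I_d := Ordinal (pd x).
have q_inj : injective q by move=> x y [/p_inj].
have /bij_eq_card : bijective q.
  by apply: inj_card_bij => //; rewrite cT card_ord.
have [q' _ q'K] : bijective q by apply: inj_card_bij => //; rewrite cT card_ord.
by exists (q' i); have := congr1 val (q'K i).
Qed.

Lemma coordset_bounded M A : fbounded M A -> bounded_tuples M (coordset d p A).
Proof.
move=> AM t At i; have [x xi] := numbering_ex i.
by have := AM _ At x; rewrite /coords xi (tnth_nth 0).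
Qed.

Lemma coords_tmix l (t u : d.-tuple RT) :
  coords p (tmix l t u) = fmix l (coords p t) (coords p u).
Proof.
have [_ pd _] := pP.
apply/funext => x; rewrite /coords /fmix.
rewrite -(tnth_nth 0 (tmix l t u) (Ordinal (pd x))) tnth_mktuple.
by rewrite !(tnth_nth 0).
Qed.

Lemma lebesgue_coordset M A : 0 <= M -> fmeasurable d p A -> fbounded M A ->
  lebesgue_tuple R d (coordset d p A) = (vol d p A)%:E.
Proof.
move=> M0 mA AM; rewrite /vol fineK// ge0_fin_numE ?measure_ge0//.
exact: le_lt_trans (lebesgue_tuple_bounded M0 mA (coordset_bounded AM)) (ltry _).
Qed.

Lemma vol_ge0 A : 0 <= vol d p A.
Proof. by rewrite fine_ge0. Qed.

Lemma vol_le M A B : 0 <= M -> fmeasurable d p A -> fmeasurable d p B -> fbounded M B ->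
  A `<=` B -> vol d p A <= vol d p B.
Proof.
move=> M0 mA mB BM AB.
have AM : fbounded M A by move=> g /AB; exact: BM.
rewrite -lee_fin -(lebesgue_coordset M0 mA AM) -(lebesgue_coordset M0 mB BM).
by apply: le_measure; rewrite ?inE// => t; exact: AB.
Qed.

Lemma vol_bounded M A : 0 <= M -> fmeasurable d p A -> fbounded M A ->
  vol d p A <= (2 * M) ^+ d.
Proof.
move=> M0 mA AM; rewrite -lee_fin -(lebesgue_coordset M0 mA AM).
exact: lebesgue_tuple_bounded (coordset_bounded AM).
Qed.

Lemma vol_cube M : 0 <= M -> vol d p [set g | forall x, `|g x| <= M] = (2 * M) ^+ d.
Proof.
move=> M0; rewrite /vol.
pose I (i : 'I_d) : set RT := `[- M, M]%classic.
have -> : coordset d p [set g | forall x, `|g x| <= M] = box I.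
  apply/seteqP; split=> t /=.
    move=> h i; have [x xi] := numbering_ex i; have := h x.
    by rewrite /coords xi -tnth_nth ler_norml /I /= in_itv.
  move=> h x; have [_ pd _] := pP; have := h (Ordinal (pd x)).
  by rewrite /I /= in_itv /= -ler_norml (tnth_nth 0).
rewrite [X in fine X]lebesgue_boxE; last by move=> i; exact: measurable_itv.
rewrite (eq_bigr (fun=> (2 * M)%:E)); last first.
  move=> i _; rewrite lebesgue_measure_itv /= lte_fin; case: ltP => h.
    by rewrite -EFinB; congr (_%:E); ring.
  by congr (_%:E); lra.
by rewrite prodEFin prodr_const card_ord.
Qed.

Lemma vol_brunn_minkowski (l M : R) A B C : 0 < l -> l < 1 -> 0 <= M ->
  fmeasurable d p A -> fmeasurable d p B -> fmeasurable d p C ->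
  fbounded M A -> fbounded M B -> fbounded M C -> fconvex A -> fconvex B ->
  (forall g h, A g -> B h -> C (fmix l g h)) ->
  vol d p A `^ (1 - l) * vol d p B `^ l <= vol d p C.
Proof.
move=> l0 l1 M0 mA mB mC AM BM CM cA cB ABC.
have conv D : fconvex D -> tconvex (coordset d p D).
  by move=> cD k k0 k1 t u Dt Du; rewrite /coordset /= coords_tmix; exact: cD.
apply: (brunn_minkowski l0 l1 M0) => //; try exact: coordset_bounded; try exact: conv.
by move=> t u At Bu; rewrite /coordset /= coords_tmix; exact: ABC.
Qed.

Lemma vol_affine (a : R) (c : T -> R) A : 0 < a -> fmeasurable d p A ->
  a ^+ d * vol d p [set g | A (fun x => a * g x + c x)] = vol d p A.
Proof.
move=> a0 mA; have [p_inj pd _] := pP.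
pose c' (i : 'I_d) : R := if [pick x | p x == i] is Some x then c x else 0.
have c'E x : c' (Ordinal (pd x)) = c x.
  rewrite /c'; case: pickP => [y /eqP /= /p_inj -> //|/(_ x)]; by rewrite eqxx.
have fineZ (k : R) (y : \bar R) : 0 < k -> fine (k%:E * y)%E = k * fine y.
  by move=> k0; case: y => [y||] //=; rewrite ?gt0_muley ?gt0_muleNy ?lte_fin//= mulr0.
rewrite /vol -[in RHS](lebesgue_tuple_affine c' a0 mA) fineZ ?exprn_gt0//.
congr (_ * fine (lebesgue_tuple R d _)); apply/seteqP; split=> t; rewrite /coordset /=;
  congr (A _); apply/funext => x; rewrite /coords;
  rewrite -(tnth_nth 0 (tuple_affine a c' t) (Ordinal (pd x))) tnth_mktuple c'E;
  by rewrite (tnth_nth 0).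
Qed.

(** Cover [-M, M] by [m] intervals of length [eta]: the choices of one interval
    for each point of [bd] cover [A] by m^|bd| pieces, one of which has at least
    the average volume. *)
Lemma vol_pigeonhole (bd : pred T) (M eta : R) (m : nat) A :
  0 <= M -> fmeasurable d p A -> fbounded M A -> 0 < eta -> (0 < m)%N -> 2 * M <= m%:R * eta ->
  exists c : T -> R,
   vol d p A <= (m ^ #|bd|)%:R *
     vol d p (A `&` near_center bd eta c).
Proof.
move=> M0 mA AM eta0 m0 mM.
pose J := {ffun {x : T | bd x} -> 'I_m}.
pose ctr (j : J) (x : T) : R := if insub x is Some y then - M + (j y)%:R * eta else 0.
pose S (j : J) := A `&` near_center bd eta (ctr j).
have mS j : fmeasurable d p (S j).
  by apply: fmeasurableI => //; exact: fmeasurable_near_center.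
have SM j : fbounded M (S j) by move=> g [/AM].
have j0 : J by exact: [ffun => Ordinal m0].
pose jm := [arg max_(j > j0) vol d p (S j)]%O.
have jmax j : vol d p (S j) <= vol d p (S jm).
  by rewrite /jm; case: arg_maxP => // i _ h; exact: h.
exists (ctr jm); rewrite -/(S jm).
have cover : coordset d p A `<=` \big[setU/set0]_(j : J) coordset d p (S j).
  move=> t At; rewrite -bigcup_seq /=.
  pose z x := (coords p t x + M) / eta.
  (* the right end point of the last interval is attributed to that interval *)
  pose k x := minn (Num.truncn (z x)) m.-1.
  have km x : (k x < m)%N by rewrite /k; lia.
  exists [ffun y : {x : T | bd x} => Ordinal (km (val y))]; first by rewrite /= mem_index_enum.
  split=> // x bx; rewrite /ctr insubT /= ffunE /=.
  have [zl zu] : coords p t x = z x * eta - M /\ 0 <= z x <= m%:R.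
    have := AM _ At x; rewrite ler_norml => /andP[h1 h2].
    rewrite /z divfK ?gt_eqF// addrK; split=> //.
    apply/andP; split; last by rewrite ler_pdivrMr//; lra.
    by apply: divr_ge0; [lra|exact: ltW].
  have /andP[z0 zm] := zu.
  have /andP[tl tu] := truncn_itv z0.
  have mE : (m%:R : R) = m.-1%:R + 1 by rewrite -[in LHS](prednK m0) -natr1.
  have [d0 d1] : 0 <= z x - (k x)%:R /\ z x - (k x)%:R <= 1.
    rewrite /k /minn; case: ltnP => h; first by rewrite -natr1 in tu; split; lra.
    have : (m.-1%:R : R) <= (Num.truncn (z x))%:R by rewrite ler_nat.
    by split; lra.
  rewrite zl ler_norml; apply/andP; split; nra.
rewrite -lee_fin EFinM -(lebesgue_coordset M0 mA AM) -(lebesgue_coordset M0 (mS jm) (SM jm)).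
apply: (@le_trans _ _ (\sum_(j : J) lebesgue_tuple R d (coordset d p (S j)))%E).
  apply: le_trans (measure_big_le _ _ _) => //.
  by apply: le_measure; rewrite ?inE//; apply: bigsetU_measurable => j _; exact: mS.
rewrite (eq_bigr (fun j => (vol d p (S j))%:E)); last first.
  by move=> j _; rewrite (lebesgue_coordset M0 (mS j) (SM j)).
rewrite sumEFin (lebesgue_coordset M0 (mS jm) (SM jm)) -EFinM lee_fin.
apply: (@le_trans _ _ (\sum_(j : J) vol d p (S jm))); first by apply: ler_sum => j _.
by rewrite sumr_const card_ffun card_ord card_sig -[leLHS]mulr_natl (_ : #|[pred x | bd x]| = #|bd|).
Qed.

End finite_index.

(** Two numberings of the same type differ by a permutation of the coordinates. *)
Lemma vol_renumber (T : finType) d (p q : T -> nat) S :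
  numbering d p -> numbering d q -> fmeasurable d p S -> vol d q S = vol d p S.
Proof.
move=> pP qP mS; have [p_inj pd _] := pP; have [q_inj qd _] := qP.
have inv (i : 'I_d) := cid (numbering_ex pP i).
pose s (i : 'I_d) : 'I_d := Ordinal (qd (sval (inv i))).
have s_inj : injective s.
  move=> i j [/q_inj e]; apply/val_inj.
  by have := svalP (inv i); rewrite e (svalP (inv j)).
rewrite /vol -(lebesgue_tuple_reindex s_inj mS); congr (fine (lebesgue_tuple R d _)).
apply/seteqP; split=> t; rewrite /coordset /=; congr (S _); apply/funext => x; rewrite /coords;
  rewrite -(tnth_nth 0 (tuple_reindex s t) (Ordinal (pd x))) tnth_mktuple (tnth_nth 0) /=;
  congr (nth _ _ (q _)); apply: p_inj; by rewrite (svalP (inv (Ordinal (pd x)))).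
Qed.

Lemma vol_reindex (T U : finType) (f : T -> U) d (p : T -> nat) (q : U -> nat) S :
  bijective f -> numbering d p -> numbering d q -> fmeasurable d p S ->
  vol d q [set g : U -> R | S (fun x => g (f x))] = vol d p S.
Proof.
move=> f_bij pP [q_inj qd cU] mS; rewrite -(vol_renumber (q := q \o f) pP)//.
split=> [|x|]; first by move=> x y /q_inj /(bij_inj f_bij).
  exact: qd.
by rewrite (bij_eq_card f_bij).
Qed.

(** Imposing the same condition on [m] disjoint blocks of [d] coordinates raises
    the volume to the power [m].  Measurability is proved together with the value,
    because the induction on [m] needs it. *)
Lemma lebesgue_tuple_blocks (T : Type) d (p : T -> nat) (S : set (T -> R)) v m :
  (forall x, (p x < d)%N) -> fmeasurable d p S ->
  lebesgue_tuple R d (coordset d p S) = v%:E ->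
  measurable [set t : (m * d).-tuple RT | forall j, (j < m)%N ->
      S (fun x => nth 0 t (j * d + p x)%N)] /\
  lebesgue_tuple R (m * d) [set t : (m * d).-tuple RT | forall j, (j < m)%N ->
      S (fun x => nth 0 t (j * d + p x)%N)] = (v ^+ m)%:E.
Proof.
move=> pd mS Sv.
have mB k : measurable [set t : (k * d).-tuple RT | forall j, (j < k)%N ->
      S (fun x => nth 0 t (j * d + p x)%N)].
  rewrite (_ : mkset _ = \bigcap_(j in [set j | (j < k)%N])
     coordset (k * d) (fun x => j * d + p x)%N S).
    apply: fin_bigcap_measurable => [|j /= jk]; first exact: finite_II.
    have bnd x : (j * d + p x < k * d)%N.
      by apply: ltn_block.
    have fP : measurable_fun setT (fun t : (k * d).-tuple RT =>
        [tuple (nth 0 t (j * d + i)%N : RT) | i < d]).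
      apply/measurable_fun_tnthP => i.
      rewrite (_ : _ \o _ = fun t : (k * d).-tuple RT => nth 0 t (j * d + i)%N).
        exact: measurable_nth.
      by apply/funext => t /=; rewrite tnth_mktuple.
    have := fP measurableT _ mS; rewrite setTI; congr measurable.
    apply/seteqP; split=> t; rewrite /coordset /=; congr (S _); apply/funext => x;
      by rewrite /coords -(tnth_nth 0 _ (Ordinal (pd x))) tnth_mktuple.
  by apply/seteqP; split.
split; first exact: mB.
elim: m => [|m IHm].
  rewrite (_ : mkset _ = [set: 0.-tuple RT]); first exact: diracT.
  by apply/seteqP; split.
have := lebesgue_tuple_cat (a := d) (b := m * d) (mB m.+1).
rewrite exprS EFinM -IHm -Sv => <-.
rewrite -product_measure1E//; last exact: mB.
congr (_ \x _)%E; apply/seteqP; split=> -[t u] /=.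
  move=> h; split.
    have := h 0%N (ltn0Sn _); rewrite mul0n /coordset /=; congr (S _).
    by apply/funext => x; rewrite add0n nth_cat size_tuple pd.
  move=> j jm; have := h j.+1 jm; congr (S _); apply/funext => x.
  by rewrite nth_cat size_tuple ltnNge mulSn -addnA leq_addr /= addKn.
move=> [St Su] [|j] jm.
  move: St; rewrite mul0n /coordset /=; congr (S _).
  by apply/funext => x; rewrite add0n nth_cat size_tuple pd.
have := Su j jm; congr (S _); apply/funext => x.
by rewrite nth_cat size_tuple ltnNge mulSn -addnA leq_addr /= addKn.
Qed.

Definition block_numbering (C T : Type) d (q : C -> nat) (p : T -> nat) (x : C * T) : nat :=
  (q x.1 * d + p x.2)%N.

Lemma block_numberingP (C T : finType) m d (q : C -> nat) (p : T -> nat) :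
  numbering m q -> numbering d p -> numbering (m * d) (block_numbering d q p).
Proof.
move=> [q_inj qm cC] [p_inj pd cT]; split.
- move=> [c x] [c' x']; rewrite /block_numbering /= => e.
  have d0 : (0 < d)%N by exact: leq_ltn_trans (pd x).
  have := congr1 (fun n => n %/ d)%N e; rewrite !divnMDl// !divn_small// !addn0 => /q_inj ->.
  by have := congr1 (fun n => n %% d)%N e; rewrite !modnMDl !modn_small// => /p_inj ->.
- move=> [c x]; rewrite /block_numbering /=.
  by apply: ltn_block.
- by rewrite card_prod cC cT.
Qed.

Lemma vol_blocks (C T : finType) m d (q : C -> nat) (p : T -> nat) M S :
  numbering m q -> numbering d p -> 0 <= M -> fmeasurable d p S -> fbounded M S ->
  vol (m * d) (block_numbering d q p) [set h : C * T -> R | forall c, S (fun x => h (c, x))] =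
  vol d p S ^+ m.
Proof.
move=> qP pP M0 mS SM; have [_ qm _] := qP; have [_ pd _] := pP.
have [_ ] := lebesgue_tuple_blocks m pd mS (lebesgue_coordset pP M0 mS SM).
move=> /(congr1 fine) /= <-; congr (fine (lebesgue_tuple R _ _)).
apply/seteqP; split=> t; rewrite /coordset /= => h.
  move=> j jm; have [c cj] := numbering_ex qP (Ordinal jm); have := h c.
  by congr (S _); apply/funext => x; rewrite /coords /block_numbering /= cj.
by move=> c; exact: h (qm c).
Qed.

Lemma near_center_mix (T : Type) (bd : pred T) (eta l : R) (c c' : T -> R) g h :
  0 < l -> l < 1 -> near_center bd eta c g -> near_center bd eta c' h ->
  near_center bd eta (fmix l c c') (fmix l g h).
Proof.
move=> l0 l1 gc hc x bx; have := gc x bx; have := hc x bx.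
have l1' : 0 < 1 - l by rewrite subr_gt0.
rewrite /fmix !ler_norml => /andP[? ?] /andP[? ?]; apply/andP; split; nra.
Qed.

Definition favg (T : Type) (r : seq (T -> R)) : T -> R :=
  fun x => (size r)%:R^-1 * \sum_(c <- r) c x.

Section quasiconcave.
Context (T : finType) (d : nat) (p : T -> nat) (pP : numbering d p).
Context (bd : pred T) (eta L : R) (L0 : 0 <= L) (W : set (T -> R)).
Context (mW : fmeasurable d p W) (WL : fbounded L W) (cW : fconvex W).

Let S c := W `&` near_center bd eta c.

(** Mixing two functions pinned to [c] and [c'] gives a function pinned to the
    mixture, so [vol_brunn_minkowski] makes the pinned volume quasi-concave in the
    pinned values. *)
Lemma vol_mix_center l c c' V : 0 < l -> l < 1 -> 0 <= V ->
  V <= vol d p (S c) -> V <= vol d p (S c') -> V <= vol d p (S (fmix l c c')).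
Proof.
move=> l0 l1 V0 Vc Vc'; have l1' : 0 < 1 - l by rewrite subr_gt0.
have mS b : fmeasurable d p (S b) by apply: fmeasurableI => //; exact: fmeasurable_near_center.
have SL b : fbounded L (S b) by move=> g [/WL].
have cS b : fconvex (S b).
  move=> k k0 k1 g h [Wg gb] [Wh hb]; split; first exact: cW.
  have := near_center_mix k0 k1 gb hb; congr (near_center _ _ _ _).
  by apply/funext => x; rewrite /fmix; ring.
apply: le_trans (vol_brunn_minkowski pP l0 l1 L0 (mS c) (mS c') (mS _)
    (SL c) (SL c') (SL _) (cS c) (cS c') _); last first.
  by move=> g h [Wg gc] [Wh hc]; split; [exact: cW|exact: near_center_mix].
rewrite -[leLHS](_ : V `^ (1 - l) * V `^ l = V).
  by apply: ler_pM; rewrite ?powR_ge0//; apply: ge0_ler_powR => //; rewrite ?nnegrE ?vol_ge0 ?ltW.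
by rewrite -powRD ?subrK ?powRr1// oner_eq0.
Qed.

Lemma vol_favg (r : seq (T -> R)) V : 0 <= V -> (0 < size r)%N ->
  (forall i, (i < size r)%N -> V <= vol d p (S (nth 0 r i))) -> V <= vol d p (S (favg r)).
Proof.
move=> V0; elim: r => [//|c r IHr] _ h.
have [r0|r0] := posnP (size r).
  have -> : favg (c :: r) = c.
    by apply/funext => x; rewrite /favg (size0nil r0) /= big_seq1 invr1 mul1r.
  exact: (h 0%N).
have n0 : (0 : R) < (size r)%:R by rewrite ltr0n.
pose l : R := (size r)%:R / (size (c :: r))%:R.
have sE : ((size (c :: r))%:R : R) = (size r)%:R + 1 by rewrite /= -natr1.
have l0 : 0 < l by rewrite divr_gt0// sE addr_gt0.
have l1 : l < 1 by rewrite ltr_pdivrMr sE ?addr_gt0// mul1r ltrDl.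
have -> : favg (c :: r) = fmix l c (favg r).
  apply/funext => x; rewrite /fmix /favg big_cons /l sE; field.
  by rewrite !gt_eqF// addr_gt0.
apply: vol_mix_center => //; first exact: (h 0%N).
by apply: IHr => // i ir; exact: (h i.+1).
Qed.

End quasiconcave.

End function_volume.

Arguments coordset {R T} d p S.
Arguments numbering {T} d p.
Arguments vol {R T} d p S.
Arguments fmeasurable {R T} d p S.
Arguments meval {R T} d p u.

(** * Cells of a torus *)

Section torus_geometry.

Definition step n (o : nat * nat) (v : torus n) : torus n :=
  (iter o.1 (@ordS n) v.1, iter o.2 (@ordS n) v.2).

(** The four vertices of a rhombus as steps from its base point: the first two
    enter the Hessian with a plus sign, the last two with a minus sign. *)
Definition rhombus (r : 'I_3) : (nat * nat) * (nat * nat) * (nat * nat) * (nat * nat) :=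
  match val r with
  | 0 => ((0, 0), (2, 1), (1, 0), (1, 1))
  | 1 => ((1, 0), (0, 1), (0, 0), (1, 1))
  | _ => ((0, 0), (1, 2), (1, 1), (0, 1))
  end%N.

Lemma hessianE (R : realType) n (r : 'I_3) (f : torus n -> R) v :
  hessian r f v = let: (p1, p2, q1, q2) := rhombus r in
    f (step p1 v) + f (step p2 v) - f (step q1 v) - f (step q2 v).
Proof. by case: v => a b; case: r => [[|[|[|]]]] //. Qed.

Lemma val_iter_ordS n i (a : 'I_n) : val (iter i (@ordS n) a) = ((a + i) %% n)%N.
Proof.
elim: i => [|i IHi]; first by rewrite addn0 modn_small.
by rewrite iterS /= IHi addnS -addn1 modnDml addn1.
Qed.

Definition rank n (v : torus n) : nat := (v.1 * n + v.2)%N.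

Lemma rankP n : numbering (n * n) (@rank n).
Proof.
split.
- move=> [a b] [a' b']; rewrite /rank /= => e.
  have n0 : (0 < n)%N by exact: leq_ltn_trans (ltn_ord a).
  have := congr1 (fun m => m %/ n)%N e; rewrite !divnMDl// !divn_small// !addn0 => /val_inj ->.
  by have := congr1 (fun m => m %% n)%N e; rewrite !modnMDl !modn_small// => /val_inj ->.
- move=> [a b]; rewrite /rank /=.
  by apply: ltn_block.
- by rewrite card_prod !card_ord.
Qed.

(** Two rows and two columns: a rhombus moves by at most two steps in each
    direction, so it cannot jump over a strip of this width. *)
Definition boundary n (x : torus n) := (x.1 < 2)%N || (x.2 < 2)%N.

Lemma card_boundary n : (#|@boundary n| <= 4 * n)%N.
Proof.
have I2 : (#|[pred a : 'I_n | (a < 2)%N]| <= 2)%N.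
  pose f (a : 'I_n) : bool := odd a.
  rewrite -[leqRHS]card_bool; apply: (leq_card_in f) => a b; rewrite !inE => ha hb.
  rewrite /f => e; apply/val_inj.
  by rewrite /=; lia.
apply: (@leq_trans (#|[predX [pred a : 'I_n | (a < 2)%N] & predT : pred 'I_n]| +
   #|[predX predT : pred 'I_n & [pred a : 'I_n | (a < 2)%N]]|)%N).
  rewrite -cardUI; apply: leq_trans (leq_addr _ _); apply/subset_leq_card/fintype.subsetP => -[a b].
  by rewrite unfold_in /boundary !inE /= !andbT.
rewrite !cardX cardT size_enum_ord (_ : 4 * n = 2 * n + n * 2)%N; last lia.
by apply: leq_add; rewrite ?leq_mul2l ?leq_mul2r I2 orbT.
Qed.

Section cells.
Context (k n : nat) (n0 : (0 < n)%N).

Definition glue1 (c : 'I_k) (x : 'I_n) : 'I_(k * n).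
Proof.
by apply: (@Ordinal (k * n) (c * n + x)%N); apply: ltn_block.
Defined.

Definition cell1 (a : 'I_(k * n)) : 'I_k.
Proof. by apply: (@Ordinal k (a %/ n)%N); rewrite ltn_divLR. Defined.

Definition red1 (a : 'I_(k * n)) : 'I_n.
Proof. by apply: (@Ordinal n (a %% n)%N); rewrite ltn_pmod. Defined.

Lemma glue1K a : glue1 (cell1 a) (red1 a) = a.
Proof. by apply/val_inj => /=; rewrite -divn_eq. Qed.

Lemma cell1K c x : cell1 (glue1 c x) = c.
Proof. by apply/val_inj => /=; rewrite divnMDl// divn_small// addn0. Qed.

Lemma red1K c x : red1 (glue1 c x) = x.
Proof. by apply/val_inj => /=; rewrite modnMDl modn_small. Qed.

Lemma red1_iter i a : red1 (iter i (@ordS _) a) = iter i (@ordS n) (red1 a).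
Proof.
by apply/val_inj => /=; rewrite !val_iter_ordS /= modn_dvdm ?dvdn_mull// modnDml.
Qed.

(** A move of at most two steps that leaves a cell ends at one of the first two
    positions of a cell. *)
Lemma cell1_iter i a : (i <= 2)%N ->
  cell1 (iter i (@ordS _) a) = cell1 a \/ (red1 (iter i (@ordS _) a) < 2)%N.
Proof.
move=> i2; have [h|h] := ltnP (a %% n + i) n.
  left; apply/val_inj => /=; rewrite val_iter_ordS.
  have e : (a + i = a %/ n * n + (a %% n + i))%N by rewrite addnA -divn_eq.
  rewrite modn_small; last first.
    rewrite e; have ak : (a %/ n < k)%N by rewrite ltn_divLR.
    by apply: ltn_block.
  by rewrite e divnMDl// (divn_small h) addn0.
right; rewrite red1_iter val_iter_ordS /=.
rewrite -(subnK h) modnDr (leq_ltn_trans (leq_mod _ _))//.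
have := ltn_pmod a n0; lia.
Qed.

Lemma cell1_shift (g : 'I_k) a :
  val (cell1 (iter (g * n) (@ordS _) a)) = ((cell1 a + g) %% k)%N.
Proof.
rewrite /= val_iter_ordS -modn_divl; congr (_ %% _)%N.
by rewrite addnC divnMDl// addnC.
Qed.

Lemma red1_shift (g : 'I_k) a : red1 (iter (g * n) (@ordS _) a) = red1 a.
Proof.
apply/val_inj; rewrite red1_iter val_iter_ordS /=.
by rewrite -[in LHS]modnDmr modnMl addn0 modn_mod.
Qed.

Definition cells : finType := ('I_k * 'I_k)%type.

Definition assemble (y : cells * torus n) : torus (k * n) :=
  (glue1 y.1.1 y.2.1, glue1 y.1.2 y.2.2).
Definition cell (v : torus (k * n)) : cells := (cell1 v.1, cell1 v.2).
Definition red (v : torus (k * n)) : torus n := (red1 v.1, red1 v.2).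

Lemma assembleK v : assemble (cell v, red v) = v.
Proof. by case: v => a b; rewrite /assemble /= !glue1K. Qed.

Lemma cellK y : cell (assemble y) = y.1.
Proof. by case: y => [[c d] [a b]]; rewrite /cell /= !cell1K. Qed.

Lemma redK y : red (assemble y) = y.2.
Proof. by case: y => [[c d] [a b]]; rewrite /red /= !red1K. Qed.

Lemma red_step o v : red (step o v) = step o (red v).
Proof. by rewrite /red /step /= !red1_iter. Qed.

Lemma cell_step o v : (o.1 <= 2)%N -> (o.2 <= 2)%N ->
  cell (step o v) = cell v \/ boundary (step o (red v)).
Proof.
move=> o1 o2; rewrite -red_step.
have [e1|h1] := cell1_iter v.1 o1; last by right; rewrite /boundary /= h1.
have [e2|h2] := cell1_iter v.2 o2; last by right; rewrite /boundary /= h2 orbT.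
by left; rewrite /cell /= e1 e2.
Qed.

(** By [cell_step], replacing at each vertex the cell of that vertex by the cell of
    the base point changes a value only at boundary points, where it changes it by
    at most [e]; a rhombus has four vertices. *)
Lemma hessian_glue (R : realType) (h : cells * torus n -> R) (e : R) r v : 0 <= e ->
  (forall c c' x, boundary x -> `|h (c, x) - h (c', x)| <= e) ->
  `|hessian r (fun w => h (cell w, red w)) v -
    hessian r (fun x => h (cell v, x)) (red v)| <= 4 * e.
Proof.
move=> e0 he; rewrite !hessianE.
have D o : (o.1 <= 2)%N -> (o.2 <= 2)%N ->
   `|h (cell (step o v), red (step o v)) - h (cell v, step o (red v))| <= e.
  move=> o1 o2; rewrite red_step; have [->|b] := cell_step v o1 o2.
    by rewrite subrr normr0.
  exact: he.
case er : (rhombus r) => [[[p1 p2] q1] q2].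
have [P1 [P2 [Q1 Q2]]] : [/\ (p1.1 <= 2)%N & (p1.2 <= 2)%N] /\ [/\ (p2.1 <= 2)%N & (p2.2 <= 2)%N] /\
   [/\ (q1.1 <= 2)%N & (q1.2 <= 2)%N] /\ [/\ (q2.1 <= 2)%N & (q2.2 <= 2)%N].
  by move: er; case: r => [[|[|[|]]]] //= _ [<- <- <- <-].
have := D _ P1.1 P1.2; have := D _ P2.1 P2.2; have := D _ Q1.1 Q1.2; have := D _ Q2.1 Q2.2.
rewrite !ler_norml => /andP[? ?] /andP[? ?] /andP[? ?] /andP[? ?].
by apply/andP; split; lra.
Qed.

End cells.
End torus_geometry.

(** * Comparison of a torus with its multiples *)

Section comparison.
Context (R : realType).

(** The cap on the values makes the set bounded without cutting out a hyperplane,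
    so that all vertices stay on the same footing. *)
Definition capped_set n (s : 'I_3 -> R) (L : R) : set (torus n -> R) :=
  [set g | (forall r v, hessian r g v <= s r) /\ forall v, `|g v| <= L].

Definition capped_volume n (s : 'I_3 -> R) (L : R) : R :=
  vol (n * n) (@rank n) (@capped_set n s L).

Lemma hessian_lin n r (a b : R) (g h : torus n -> R) v :
  hessian r (fun x => a * g x + b * h x) v = a * hessian r g v + b * hessian r h v.
Proof. by rewrite !hessianE; case: (rhombus r) => [[[? ?] ?] ?]; ring. Qed.

Lemma fmeasurable_hessian n d (p : torus n -> nat) r v (c : R) :
  fmeasurable d p [set g | hessian r g v <= c].
Proof.
apply: (@fmeasurable_le _ _ d p (fun g => hessian r g v)).
under [X in meval _ _ X]boolp.eq_fun do rewrite hessianE.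
case: (rhombus r) => [[[p1 p2] q1] q2].
exact: (mevalB (mevalB (mevalD (meval_pt p _) (meval_pt p _)) (meval_pt p _)) (meval_pt p _)).
Qed.

Lemma fmeasurable_capped_set n d (p : torus n -> nat) s L : fmeasurable d p (capped_set s L).
Proof.
apply: fmeasurableI.
  apply: (@fmeasurable_forall _ _ d p _ (fun r => [set g : torus n -> R | forall v, hessian r g v <= s r])) => r.
  apply: (@fmeasurable_forall _ _ d p _ (fun v => [set g : torus n -> R | hessian r g v <= s r])) => v.
  exact: fmeasurable_hessian.
apply: (@fmeasurable_forall _ _ d p _ (fun v => [set g : torus n -> R | `|g v| <= L])) => v.
apply: (@fmeasurable_norm _ _ d p (fun g => g v)); exact: meval_pt.
Qed.

Lemma capped_set_bounded n s L : fbounded L (@capped_set n s L).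
Proof. by move=> g []. Qed.

Lemma capped_set_convex n s L : fconvex (@capped_set n s L).
Proof.
move=> l l0 l1 g h [gD gL] [hD hL]; have l1' : 0 < 1 - l by rewrite subr_gt0.
split=> [r v|v].
  rewrite hessian_lin; have := gD r v; have := hD r v; nra.
have := gL v; have := hL v; rewrite /fmix !ler_norml => /andP[? ?] /andP[? ?].
apply/andP; split; nra.
Qed.

Lemma capped_volume_scale n s L (a : R) : 0 < a ->
  capped_volume n (fun r => a * s r) (a * L) = a ^+ (n * n) * capped_volume n s L.
Proof.
move=> a0; have := vol_affine (rankP n) (fun=> 0) a0
  (@fmeasurable_capped_set n (n * n) (@rank n) (fun r => a * s r) (a * L)).
rewrite /capped_volume => <-; congr (_ * vol _ _ _); apply/seteqP.
have hE g r v : hessian r (fun x : torus n => a * g x + 0) v = a * hessian r g v.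
  by rewrite (_ : (fun x => _) = fun x => a * g x + 0 * g x) ?hessian_lin ?mul0r ?addr0//;
    apply/funext => x; rewrite mul0r.
by split=> g [gD gL]; split=> [r v|v]; have := gD; have := gL => gL' gD';
  [have := gD r v|have := gL v|have := gD r v|have := gL v];
  rewrite ?hE ?addr0 ?normrM ?(gtr0_norm a0) ler_pM2l.
Qed.

Lemma capped_volume_le n s s' L L' : 0 <= L' -> (forall r, s r <= s' r) -> L <= L' ->
  capped_volume n s L <= capped_volume n s' L'.
Proof.
move=> L0 ss' LL'; apply: (vol_le (rankP n) L0);
  try exact: fmeasurable_capped_set; first exact: capped_set_bounded.
by move=> g [gD gL]; split=> [r v|v]; [exact: le_trans (gD _ _) _|exact: le_trans (gL _) _].
Qed.

Lemma capped_volume_ge0 n s L : 0 <= capped_volume n s L.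
Proof. exact: vol_ge0. Qed.

Section compare.
Context (k' n : nat) (n0 : (0 < n)%N) (s : 'I_3 -> R) (L eta : R) (m : nat).
Let k := k'.+1.
Context (L0 : 0 <= L) (eta0 : 0 < eta) (m0 : (0 < m)%N) (mL : 2 * L <= m%:R * eta).
Let T := (cells k * torus n)%type.
Let q : T -> nat := block_numbering (n * n) (@rank k) (@rank n).
(* four vertices, each off by at most twice the pinning tolerance *)
Let s' r := s r + 8 * eta.

Let qP : numbering ((k * k) * (n * n)) q.
Proof. exact: block_numberingP (rankP k) (rankP n). Qed.

Let ungl (h : T -> R) : torus (k * n) -> R := fun v => h (cell n0 v, red n0 v).

Let capped_volume_glued u M : capped_volume (k * n) u M =
  vol ((k * k) * (n * n)) q [set h | capped_set u M (ungl h)].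
Proof.
pose f v : T := (cell n0 v, red n0 v).
have f_bij : bijective f.
  exists (@assemble k n) => [v|y]; first exact: assembleK.
  by rewrite /f cellK redK -surjective_pairing.
have e : ((k * k) * (n * n) = (k * n) * (k * n))%N by rewrite mulnACA.
have rP : numbering ((k * k) * (n * n)) (@rank (k * n)) by rewrite e; exact: rankP.
rewrite /capped_volume -e; apply/esym/(vol_reindex f_bij rP qP).
exact: fmeasurable_capped_set.
Qed.

Let W u : set (T -> R) := [set h | capped_set u L (ungl h)].

Let mW u d (p : T -> nat) : fmeasurable d p (W u).
Proof. exact: (@fmeasurable_capped_set (k * n) _ (fun v => p (cell n0 v, red n0 v))). Qed.

Let WL u : fbounded L (W u).
Proof.
move=> h [_ hL] y; have := hL (assemble y).
by rewrite /ungl cellK redK -surjective_pairing.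
Qed.

Let cW u : fconvex (W u).
Proof. by move=> l l0 l1 g h Wg Wh; exact: (capped_set_convex l0 l1 Wg Wh). Qed.

Let ungl_error (h : T -> R) r v :
  (forall c c' x, boundary x -> `|h (c, x) - h (c', x)| <= 2 * eta) ->
  `|hessian r (ungl h) v - hessian r (fun x => h (cell n0 v, x)) (red n0 v)| <= 8 * eta.
Proof.
move=> hh; rewrite (_ : 8 * eta = 4 * (2 * eta)); last by ring.
by apply: hessian_glue => //; rewrite mulr_ge0// ltW.
Qed.

(** Functions on the n-torus that are pinned to the same values on the boundary can
    be glued independently in the k^2 cells. *)
Lemma capped_volume_pow_le : capped_volume n s L ^+ (k * k) <=
  (m ^ (4 * n))%:R ^+ (k * k) * capped_volume (k * n) s' L.
Proof.
have [c hc] := vol_pigeonhole (rankP n) (@boundary n) L0 (@fmeasurable_capped_set n (n * n) (@rank n) s L)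
  (@capped_set_bounded n s L) eta0 m0 mL.
rewrite -/(capped_volume n s L) in hc.
set S := capped_set s L `&` _ in hc.
have mS d p : fmeasurable d p S.
  by apply: measurableI; [exact: fmeasurable_capped_set|exact: fmeasurable_near_center].
have SL : fbounded L S by move=> g [/capped_set_bounded].
apply: (@le_trans _ _ (((m ^ (4 * n))%:R * vol (n * n) (@rank n) S) ^+ (k * k))).
  rewrite lerXn2r ?nnegrE ?capped_volume_ge0 ?mulr_ge0 ?vol_ge0//.
  apply: le_trans hc _; rewrite ler_wpM2r ?vol_ge0// ler_nat leq_pexp2l//.
  exact: card_boundary.
rewrite exprMn ler_wpM2l ?exprn_ge0// -(vol_blocks (rankP k) (rankP n) L0 (mS _ _) SL).
have mblocks : fmeasurable ((k * k) * (n * n)) q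
    [set h : T -> R | forall c, S (fun x => h (c, x))].
  by refine (@fmeasurable_forall _ _ _ _ _
    (fun c => [set h : T -> R | S (fun x => h (c, x))]) _) => c0;
    exact: (mS _ (fun x => q (c0, x))).
rewrite capped_volume_glued; refine (vol_le qP L0 mblocks (mW s' _) (@WL s') _).
move=> h hS; split=> [r v|v]; last first.
  by have [[_ b] _] := hS (cell n0 v); exact: (b (red n0 v)).
have err : `|hessian r (ungl h) v - hessian r (fun x => h (cell n0 v, x)) (red n0 v)| <= 8 * eta.
  apply: ungl_error => c1 c2 x bx.
  have [_ /(_ x bx)] := hS c1; have [_ /(_ x bx)] := hS c2.
  by rewrite !ler_norml => /andP[? ?] /andP[? ?]; apply/andP; split; lra.
have [[/(_ r (red n0 v)) D _] _] := hS (cell n0 v).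
by move: err D; rewrite ler_norml /s' => /andP[_ ?] ?; lra.
Qed.

Let translate (g : cells k) (y : T) : T := ((y.1.1 + g.1, y.1.2 + g.2), y.2).

Let translate_bij g : bijective (translate g).
Proof.
exists (fun y : T => ((y.1.1 - g.1, y.1.2 - g.2), y.2)) => -[[c d] x];
  by rewrite /translate /= ?addrK ?subrK.
Qed.

Let W_translate u g h : W u h -> W u (fun y => h (translate g y)).
Proof.
pose tv (v : torus (k * n)) : torus (k * n) := step (g.1 * n, g.2 * n)%N v.
have E : ungl (fun y => h (translate g y)) = fun v => ungl h (tv v).
  apply/funext => v; rewrite /ungl /translate /=; congr h; congr pair.
    by rewrite /cell /=; congr pair; apply/val_inj; rewrite [RHS]cell1_shift.
  by rewrite /red /= !red1_shift.
move=> [hD hL]; rewrite /W /= E; split=> [r v|v]; last exact: hL.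
have -> : hessian r (fun v => ungl h (tv v)) v = hessian r (ungl h) (tv v).
  rewrite !hessianE.
  have C o w : tv (step o w) = step o (tv w).
    by rewrite /tv /step /=; congr pair; rewrite -!iterD addnC.
  by case: (rhombus r) => [[[? ?] ?] ?]; rewrite !C.
exact: hD.
Qed.

Let bd (y : T) := boundary y.2.

Let card_bd : (#|bd| <= k * k * (4 * n))%N.
Proof.
rewrite (_ : #|bd| = #|[predX predT : pred (cells k) & @boundary n]|); last first.
  by apply: eq_card => -[c x]; rewrite !inE.
by rewrite cardX card_prod !card_ord leq_mul2l card_boundary orbT.
Qed.

(** The pinned volume on the large torus does not decrease when the pinned values
    are averaged over the translations by cells.  Functions pinned to the averages
    almost agree on the boundaries of all cells, so each of their restrictions
    almost satisfies the Hessian bounds on the small torus. *)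
Lemma capped_volume_le_pow : capped_volume (k * n) s L <=
  (m ^ (4 * n))%:R ^+ (k * k) * capped_volume n s' L ^+ (k * k).
Proof.
rewrite capped_volume_glued -/(W s).
have [c hc] := vol_pigeonhole qP bd L0 (mW s _) (@WL s) eta0 m0 mL.
pose S c := W s `&` near_center bd eta c.
have mS b d p : fmeasurable d p (S b).
  by apply: measurableI; [exact: mW|exact: fmeasurable_near_center].
have SL b : fbounded L (S b) by move=> g [/WL].
pose V := vol ((k * k) * (n * n)) q (S c).
(* the translates of the pinned values, whose average is independent of the cell *)
pose centers := [seq (fun y => c (translate g y)) | g <- index_enum (cells k)].
have Vavg : V <= vol ((k * k) * (n * n)) q (S (favg centers)).
  apply: (vol_favg qP L0 (mW s _) (@WL s) (@cW s)); first exact: vol_ge0.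
    by rewrite size_map -sum1_size sum1_card card_prod !card_ord muln_gt0.
  move=> i; rewrite size_map => ic.
  rewrite (nth_map (0, 0))//; set g := nth _ _ _.
  rewrite -/(S _) -[leRHS](vol_reindex (translate_bij g) qP qP (mS _ _ _)).
  apply: (vol_le qP L0 (mS c _ _)) => [|h hS y|h [Wh hc']].
  - exact: (mS _ _ (fun y => q (translate g y))).
  - have [tr' trK tr'K] := translate_bij g; rewrite -(tr'K y).
    exact: (SL _ _ hS).
  - split; first exact: W_translate.
    by move=> y yb; exact: (hc' (translate g y)).
have avgE c1 c2 x : favg centers (c1, x) = favg centers (c2, x).
  rewrite /favg /centers; congr (_ * _); rewrite !big_map /=.
  have E a : \sum_(g : cells k) c (translate g (a, x)) = \sum_(g : cells k) c (g, x).
    rewrite [RHS](reindex_inj (addrI (a : 'I_k * 'I_k)%type)) /=.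
    by apply: eq_bigr => g _; rewrite /translate; case: a g => [? ?] [? ?].
  by rewrite !E.
have sub : S (favg centers) `<=` [set h | forall a, capped_set s' L (fun x => h (a, x))].
  move=> h [Wh hb] a; split=> [r x|x]; last exact: (WL Wh).
  have err : `|hessian r (ungl h) (assemble (a, x)) - hessian r (fun x => h (a, x)) x| <= 8 * eta.
    have := @ungl_error h r (assemble (a, x)); rewrite cellK redK; apply=> c1 c2 z bz.
    have := hb (c1, z) bz; have := hb (c2, z) bz.
    rewrite (avgE c1 c2) !ler_norml => /andP[? ?] /andP[? ?]; apply/andP; split; lra.
  have D : hessian r (ungl h) (assemble (a, x)) <= s r := Wh.1 r (assemble (a, x)).
  by move: err D; rewrite ler_norml /s' => /andP[? _] ?; lra.
have mB : fmeasurable ((k * k) * (n * n)) q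
    [set h : T -> R | forall a, capped_set s' L (fun x => h (a, x))].
  by refine (@fmeasurable_forall _ _ _ _ _
    (fun a => [set h : T -> R | capped_set s' L (fun x => h (a, x))]) _) => a;
    exact: (@fmeasurable_capped_set _ _ (fun x => q (a, x))).
have BL : fbounded L [set h : T -> R | forall a, capped_set s' L (fun x => h (a, x))].
  by move=> h hO [a x]; exact: (hO a).2.
apply: le_trans hc _.
apply: (@le_trans _ _ ((m ^ (k * k * (4 * n)))%:R * V)).
  rewrite ler_wpM2r ?vol_ge0// ler_nat leq_pexp2l//; exact: card_bd.
rewrite mulnC expnM natrX ler_wpM2l ?exprn_ge0//.
apply: le_trans Vavg _.
rewrite -(vol_blocks (rankP k) (rankP n) L0 (fmeasurable_capped_set _ _ _) (@capped_set_bounded n s' L)).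
exact: (vol_le qP L0 (mS (favg centers) _ _) mB BL sub).
Qed.

End compare.
End comparison.

(** * From the polytope to a full-dimensional body *)

Section diameter.
Context (R : realType).

(** The first differences of a periodic sequence sum up to zero over a period, so
    one of them is nonpositive; going forward from there they increase by at most
    [sigma] at each step, so within one period they stay below [n * sigma]. *)
Lemma periodic_second_difference (h : nat -> R) n (sigma : R) : (0 < n)%N -> 0 <= sigma ->
  (forall i, h (i + n)%N = h i) ->
  (forall i, h i.+2 - 2 * h i.+1 + h i <= sigma) ->
  forall i t, h (i + t)%N - h i <= t%:R * (n%:R * sigma).
Proof.
move=> n0 s0 hn hs.
pose d i := h i.+1 - h i.
have dn i : d (i + n)%N = d i by rewrite /d -addSn !hn.
have dS i j : d (i + j)%N <= d i + j%:R * sigma.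
  elim: j => [|j IHj]; first by rewrite addn0 mul0r addr0.
  have := hs (i + j)%N; rewrite addnS -natr1 mulrDl mul1r; move: IHj; rewrite /d; lra.
have [i0 i0n d0] : exists2 i0, (i0 < n)%N & d i0 <= 0.
  apply: contrapT => /forall2NP H.
  have : 0 < \sum_(0 <= i < n) d i.
    rewrite big_mkord (bigD1 (Ordinal n0)) //= ltr_pwDl//.
      by case: (H 0%N) => [/(_ n0)//|]; move/negP; rewrite -ltNge.
    apply: sumr_ge0 => i _; case: (H i) => [/(_ (ltn_ord i))//|].
    by move/negP; rewrite -ltNge => /ltW.
  by rewrite telescope_sumr// -[n]add0n hn subrr ltxx.
have dle i : d i <= n%:R * sigma.
  rewrite (divn_eq i n); set q := (i %/ n)%N; set r := (i %% n)%N.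
  have rn : (r < n)%N by rewrite ltn_pmod.
  have -> : d (q * n + r)%N = d r.
    by elim: q => [|q IHq]; rewrite ?mul0n// mulSn [(n + _)%N]addnC -addnA [(n + r)%N]addnC addnA dn.
  have step j : (j <= n)%N -> d (i0 + j)%N <= n%:R * sigma.
    move=> jn; apply: le_trans (dS i0 j) _.
    have : j%:R * sigma <= n%:R * sigma by rewrite ler_wpM2r// ler_nat.
    lra.
  have [ir|ri] := leqP i0 r.
    by rewrite -(subnKC ir); apply: step; lia.
  by rewrite -dn (_ : r + n = i0 + (r + n - i0))%N; [apply: step; lia|lia].
move=> i; elim=> [|t IHt]; first by rewrite addn0 subrr mul0r.
rewrite addnS -natr1 mulrDl mul1r.
have := dle (i + t)%N; rewrite /d; lra.
Qed.

Definition slope_sum (s : 'I_3 -> R) : R := \sum_r s r.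

Lemma iter_ordS_onto n (a a' : 'I_n) : exists2 t, (t <= n)%N & iter t (@ordS n) a = a'.
Proof.
have n0 : (0 < n)%N by exact: leq_ltn_trans (ltn_ord a).
exists ((a' + n - a) %% n)%N; first by rewrite ltnW// ltn_pmod.
apply/val_inj; rewrite val_iter_ordS modnDmr subnKC.
  by rewrite modnDr modn_small.
by rewrite (leq_trans (ltnW (ltn_ord a)))// leq_addl.
Qed.

Lemma iter_ordS_period n (a : 'I_n) i : iter (i + n) (@ordS n) a = iter i (@ordS n) a.
Proof. by apply/val_inj; rewrite !val_iter_ordS addnA modnDr. Qed.

(** The second difference along a row is the sum of the Hessians on two rhombi of
    the families 0 and 1, and along a column of the families 2 and 1.  So rows and
    columns are periodic sequences with second differences bounded above. *)
Lemma hessian_diameter n (s : 'I_3 -> R) (g : torus n -> R) : (forall r, 0 < s r) ->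
  (forall r v, hessian r g v <= s r) ->
  forall v w, g v - g w <= 2 * (n%:R ^+ 2 * slope_sum s).
Proof.
move=> s0 gD [a b] [a' b'].
have n0 : (0 < n)%N by exact: leq_ltn_trans (ltn_ord a).
have tE : slope_sum s = s ord0 + s (inord 1) + s (inord 2).
  rewrite /slope_sum !big_ord_recl big_ord0 addr0 addrA; congr (s _ + s _ + s _);
    by apply/val_inj; rewrite /= ?inordK.
have t0 : 0 <= slope_sum s by apply: sumr_ge0 => r _; rewrite ltW.
have v1 : val (inord 1 : 'I_3) = 1%N by rewrite /= inordK.
have v2 : val (inord 2 : 'I_3) = 2%N by rewrite /= inordK.
have bound t : (t <= n)%N -> t%:R * (n%:R * slope_sum s) <= n%:R ^+ 2 * slope_sum s.
  by move=> tn; rewrite mulrA ler_wpM2r// expr2 ler_wpM2r// ler_nat.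
have row : g (a, b) - g (a', b) <= n%:R ^+ 2 * slope_sum s.
  have [t tn <-] := iter_ordS_onto a' a.
  apply: le_trans (bound _ tn).
  apply: (@periodic_second_difference (fun i => g (iter i (@ordS n) a', b)) n _ n0 t0 _ _ 0%N).
    by move=> i /=; rewrite iter_ordS_period.
  move=> i /=; set x := iter i _ a'.
  have := gD ord0 (x, b); have := gD (inord 1) (ordS x, b).
  rewrite /hessian v1 /= tE; have := s0 (inord 2); lra.
have col : g (a', b) - g (a', b') <= n%:R ^+ 2 * slope_sum s.
  have [t tn <-] := iter_ordS_onto b' b.
  apply: le_trans (bound _ tn).
  apply: (@periodic_second_difference (fun i => g (a', iter i (@ordS n) b')) n _ n0 t0 _ _ 0%N).
    by move=> i /=; rewrite iter_ordS_period.
  move=> i /=; set x := iter i _ b'.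
  have := gD (inord 2) (a', x); have := gD (inord 1) (a', ordS x).
  rewrite /hessian v1 v2 /= tE; have := s0 ord0; lra.
lra.
Qed.

End diameter.

Section gram.
Context (R : realType).

(** Two triangular factorisations of the same block matrix: with a column [c] and a
    row [r], the determinant of 1 + c r equals that of the scalar 1 + r c. *)
Lemma det_addI_ones d : \det (1%:M + const_mx 1 : 'M[R]_d) = d.+1%:R.
Proof.
pose r : 'M[R]_(1, d) := const_mx 1; pose c : 'M[R]_(d, 1) := const_mx 1.
have -> : const_mx 1 = c *m r.
  by apply/matrixP => i j; rewrite !mxE big_ord1 !mxE mulr1.
have rc : r *m c = d%:R%:M.
  apply/matrixP => i j; rewrite !mxE !ord1 (eq_bigr (fun=> 1)); last first.
    by move=> k _; rewrite !mxE mulr1.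
  by rewrite sumr_const card_ord mulr1n.
have e1 : block_mx 1%:M (- r) c 1%:M = block_mx 1%:M 0 c 1%:M *m block_mx 1%:M (- r) 0 (1%:M + c *m r).
  rewrite mulmx_block !mul1mx !mul0mx !mulmx1 !addr0 mulmxN; congr block_mx.
  by rewrite addrC addrK.
have e2 : block_mx 1%:M (- r) c 1%:M = block_mx (1%:M + r *m c) (- r) 0 1%:M *m block_mx 1%:M 0 c 1%:M.
  rewrite mulmx_block !mulmx0 !mul0mx !mulmx1 !mul1mx !add0r; congr block_mx.
  by rewrite mulNmx addrK.
have := congr1 determinant e1; rewrite e2 !det_mulmx !det_ublock !det_lblock !det1 !mul1r !mulr1.
by move=> <-; rewrite rc det_mx11 !mxE eqxx !mulr1n -natr1 addrC.
Qed.

Lemma det_gram n : (0 < n)%N ->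
  \det (\matrix_(i < n ^ 2 - 1, j < n ^ 2 - 1)
     \sum_x @mean_zero_basis R n i x * @mean_zero_basis R n j x) = (n ^ 2)%:R.
Proof.
move=> n0; have n2 : (0 < n ^ 2)%N by rewrite expn_gt0 n0.
rewrite -[in RHS](prednK n2) -subn1 -det_addI_ones; congr (\det _).
apply/matrixP => i j; rewrite !mxE.
rewrite (eq_bigr (fun x : torus n =>
    (rank x == i.+1)%:R * (i == j)%:R + (rank x == 0%N)%:R)); last first.
  move=> x _; rewrite /mean_zero_basis -/(rank x).
  case: eqVneq => [->|_]; rewrite /=.
    by rewrite eqSS (inj_eq val_inj); ring.
  by case: eqVneq => [->|_] /=; ring.
have one k : (k < n ^ 2)%N -> \sum_(x : torus n) ((rank x == k)%:R : R) = 1.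
  move=> kn; have [x xk] := numbering_ex (rankP n) (Ordinal kn : 'I_(n * n)).
  rewrite (bigD1 x)//= xk eqxx big1 ?addr0// => y yx.
  case: eqP => // yk; case/eqP: yx; have [inj _ _] := rankP n; apply: inj.
  by rewrite yk xk.
rewrite big_split /= -mulr_suml !one//; last by have := ltn_ord i; lia.
by rewrite mul1r.
Qed.

End gram.

Section shear.
Context (R : realType).
Local Notation RT := (measurableTypeR R).
Local Notation mu := (@lebesgue_measure R).

Definition tsum d (t : d.-tuple RT) : R := \sum_i tnth t i.

Lemma measurable_tsum d : measurable_fun setT (@tsum d : _ -> RT).
Proof.
apply: measurable_sum => i; exact: measurable_tnth.
Qed.

Lemma tsum_cons d (x : RT) (t : d.-tuple RT) : tsum (cons_pair (x, t)) = x + tsum t.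
Proof. by rewrite /tsum big_ord_recl /=; congr (_ + _); apply: eq_bigr => i _; rewrite tnthS. Qed.

Lemma tsum_shift d (c : R) (t : d.-tuple RT) :
  tsum (tuple_affine 1 (fun=> c) t) = tsum t + d%:R * c.
Proof.
rewrite /tsum (eq_bigr (fun i => tnth t i + c)); last first.
  by move=> i _; rewrite tnth_mktuple mul1r.
by rewrite big_split /= sumr_const card_ord mulr_natl.
Qed.

Lemma shift_cons d (c : R) (x : RT) (t : d.-tuple RT) :
  tuple_affine 1 (fun=> c) (cons_pair (x, t)) = cons_pair (x + c, tuple_affine 1 (fun=> c) t).
Proof.
apply: eq_from_tnth => i; rewrite tnth_mktuple.
by case: (unliftP ord0 i) => [j ->|->]; rewrite ?tnthS ?tnth_mktuple ?mul1r.
Qed.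

Lemma shiftK d (c : R) (t : d.-tuple RT) :
  tuple_affine 1 (fun=> - c) (tuple_affine 1 (fun=> c) t) = t.
Proof. by apply: eq_from_tnth => i; rewrite !tnth_mktuple !mul1r addrK. Qed.

(** For a set invariant under adding constants, every section by a hyperplane of
    constant sum is a translate of the section of sum zero.  The two shears
    (x, t) to (x + sum t, t) and (m, t) to (m, t - m / (d + 1)) make this precise:
    each translates one variable while the other is fixed, so it preserves
    volume. *)
Lemma slab_volume d (E : set (d.+1.-tuple RT)) (a b : R) : a <= b -> measurable E ->
  (forall c t, E t -> E (tuple_affine 1 (fun=> c) t)) ->
  (lebesgue_tuple R d.+1 (E `&` [set t | (a <= tsum t <= b)%R]) =
   (b - a)%:E * lebesgue_tuple R d [set t | E (cons_pair ((- tsum t)%R : RT, t))])%E.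
Proof.
move=> ab mE Einv.
have Einv' c t : E (tuple_affine 1 (fun=> c) t) -> E t.
  by move=> /(Einv (- c)); rewrite shiftK.
pose S := E `&` [set t | a <= tsum t <= b].
have mS : measurable S.
  apply: measurableI => //.
  rewrite (_ : mkset _ = (fun t : d.+1.-tuple RT => tsum t : RT) @^-1` `[a, b]%classic).
    by rewrite -[X in measurable X]setTI; exact: measurable_tsum.
  by apply/seteqP; split=> t; rewrite /= in_itv.
(* in the coordinates (sum, t) the first coordinate of the tuple is recovered by subtraction *)
pose shear (p : RT * d.-tuple RT) : d.+1.-tuple RT := cons_pair (p.1 - tsum p.2 : RT, p.2).
have mshear : measurable_fun setT shear.
  apply: measurable_cons; last exact: measurable_snd.
  apply: measurable_funB; first exact: measurable_fst.
  by apply: measurableT_comp; [exact: measurable_tsum|exact: measurable_snd].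
pose S2 : set (RT * d.-tuple RT) := (`[a, b]%classic `*` setT) `&` (shear @^-1` E).
have mS2 : measurable S2.
  apply: measurableI; first by apply: measurableX => //; exact: measurable_itv.
  by rewrite -[X in measurable X]setTI; exact: mshear.
set Q := [set t | E _].
have S2x m : xsection S2 m = [set t | a <= m <= b /\ E (shear (m, t))].
  apply/seteqP; split=> t; rewrite /xsection /= inE /S2 /=.
    by rewrite in_itv /= => -[[? _] ?].
  by rewrite in_itv /= => -[? ?].
have mQ : measurable Q.
  have -> : Q = xsection ([set: RT] `*` setT `&` shear @^-1` E) 0.
    apply/seteqP; split=> t; rewrite /xsection /= inE /shear /= sub0r.
      by [].
    by case.
  apply: measurable_xsection; apply: measurableI; first exact: measurableX.
  by rewrite -[X in measurable X]setTI; exact: mshear.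
rewrite lebesgue_tupleS; under eq_integral do rewrite slice_xsection.
rewrite (sections_swap _ _ (measurable_cons_preimage mS)).
transitivity (\int[lebesgue_tuple R d]_t mu (ysection S2 t))%E.
  apply: eq_integral => t _.
  rewrite -(lebesgue_measure_affine (tsum t) (ltr01) (measurable_ysection t mS2)) mul1e.
  congr mu; apply/seteqP; split=> x; rewrite /ysection /= !inE /S2 /S /shear /=.
    by move=> [Ex]; rewrite in_itv /= tsum_cons mul1r addrK; split.
  by rewrite in_itv /= mul1r addrK tsum_cons => -[[? _] ?]; split.
rewrite -(sections_swap _ _ mS2).
transitivity (\int[mu]_(m in `[a, b]) lebesgue_tuple R d Q)%E; last first.
  rewrite integral_cst; last exact: measurable_itv.
  rewrite muleC; congr (_ * _)%E; rewrite [LHS]lebesgue_measure_itv /= lte_fin.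
  case: ltP => // ba; have -> : a = b by apply/le_anti; rewrite ab.
  by rewrite subrr.
rewrite [RHS]integral_mkcond; apply: eq_integral => m _; rewrite patchE S2x.
case: ifPn => [/set_mem|/negP mab]; last first.
  rewrite (_ : mkset _ = set0) ?measure0//; apply/seteqP; split=> // t [] h _.
  by case: mab; apply/mem_set; rewrite /= in_itv.
rewrite /= in_itv /= => mab.
(* adding c to all d + 1 coordinates raises the sum from 0 to m *)
pose c := m / d.+1%:R.
have mX : measurable [set t | a <= m <= b /\ E (shear (m, t))].
  by rewrite -S2x; exact: measurable_xsection.
rewrite -(lebesgue_tuple_affine (fun=> c) ltr01 mX) expr1n mul1e.
congr (lebesgue_tuple R d _).
have key t : shear (m, tuple_affine 1 (fun=> c) t) =
    tuple_affine 1 (fun=> c) (cons_pair ((- tsum t)%R : RT, t)).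
  rewrite shift_cons /shear /= tsum_shift; congr (cons_pair (_, _)).
  rewrite /c -natr1; field.
  by rewrite natr1 pnatr_eq0.
apply/seteqP; split=> t; rewrite /= key.
  by move=> [_ /Einv'].
by move=> Et; split=> //; exact: Einv.
Qed.

End shear.

Section polytope.
Context (R : realType).
Local Notation RT := (measurableTypeR R).

Lemma sum_coords (T : finType) d (p : T -> nat) (t : d.-tuple RT) : numbering d p ->
  \sum_x coords p t x = tsum t.
Proof.
move=> pP; have [p_inj pd cT] := pP.
pose f x : 'I_d := Ordinal (pd x).
have f_bij : bijective f.
  by apply: inj_card_bij; [move=> x y [/p_inj]|rewrite cT card_ord].
rewrite /tsum (reindex f) /=; last exact: onW_bij.
by apply: eq_bigr => x _; rewrite (tnth_nth 0).
Qed.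

(** The capped set lies between two slabs of the set of all functions with the given
    Hessian bounds: it contains the slab where the sum is in [0, 1], since there
    the values are bounded by the oscillation plus one, and it is contained in the
    slab where the sum is at most n^2 L in absolute value.  The two slabs are
    measured by [slab_volume]; the factor [n] is the square root of the Gram
    determinant n^2. *)
Lemma polytope_volume_bounds n (s : 'I_3 -> R) (L : R) : (0 < n)%N -> (forall r, 0 < s r) ->
  2 * (n%:R ^+ 2 * slope_sum s) + 1 <= L ->
  fine (polytope_volume n s) <= n%:R * capped_volume n s L /\
  n%:R * capped_volume n s L <= 2 * n%:R ^+ 2 * L * fine (polytope_volume n s).
Proof.
move=> n0 s0 hL.
have L0 : 0 <= L.
  apply: le_trans hL; rewrite addr_ge0// mulr_ge0// mulr_ge0 ?exprn_ge0//.
  by apply: sumr_ge0 => r _; rewrite ltW.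
set d := (n ^ 2 - 1)%N.
have e : (n * n = d.+1)%N by rewrite /d subn1 prednK ?expn_gt0 ?n0.
have rP : numbering d.+1 (@rank n) by rewrite -e; exact: rankP.
have [rk_inj rk_lt _] := rP.
pose H : set (torus n -> R) := [set g | forall r v, hessian r g v <= s r].
have mH : fmeasurable d.+1 (@rank n) H.
  refine (@fmeasurable_forall _ _ _ _ _ (fun r => [set g : torus n -> R | forall v, hessian r g v <= s r]) _) => r.
  refine (@fmeasurable_forall _ _ _ _ _ (fun v => [set g : torus n -> R | hessian r g v <= s r]) _) => v.
  exact: fmeasurable_hessian.
pose E := coordset d.+1 (@rank n) H.
have Einv c t : E t -> E (tuple_affine 1 (fun=> c) t).
  move=> Et r v; have := Et r v; congr (_ <= _).
  have cE x : coords (@rank n) (tuple_affine 1 (fun=> c) t) x = coords (@rank n) t x + c.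
    rewrite /coords -(tnth_nth 0 _ (Ordinal (rk_lt x))) tnth_mktuple mul1r.
    by rewrite (tnth_nth 0).
  by rewrite !hessianE; case: (rhombus r) => [[[? ?] ?] ?]; rewrite !cE; ring.
pose Q := [set t : d.-tuple RT | E (cons_pair ((- tsum t)%R : RT, t))].
pose q := fine (lebesgue_tuple R d Q).
pose Om := coordset d.+1 (@rank n) (capped_set s L).
have mOm : measurable Om by exact: fmeasurable_capped_set.
have slab a b : a <= b -> (lebesgue_tuple R d.+1 (E `&` [set t | (a <= tsum t <= b)%R]) =
   (b - a)%:E * lebesgue_tuple R d Q)%E by move=> ab; exact: slab_volume.
have mslab a b : measurable (E `&` [set t | (a <= tsum t <= b)%R]).
  apply: measurableI => //.
  rewrite (_ : mkset _ = (fun t : d.+1.-tuple RT => tsum t : RT) @^-1` `[a, b]%classic).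
    by rewrite -[X in measurable X]setTI; exact: measurable_tsum.
  by apply/seteqP; split=> t; rewrite /= in_itv.
have B_E : (capped_volume n s L)%:E = lebesgue_tuple R d.+1 Om.
  rewrite /capped_volume e (lebesgue_coordset rP L0)//; exact: capped_set_bounded.
have n2 : (d.+1%:R : R) = n%:R ^+ 2 by rewrite -e natrM expr2.
have n2gt0 : (0 : R) < n%:R ^+ 2 by rewrite exprn_gt0// ltr0n.
have Q_le : (lebesgue_tuple R d Q <= lebesgue_tuple R d.+1 Om)%E.
  have := slab 0 1 ler01; rewrite subr0 mul1e => <-.
  apply: le_measure; rewrite ?inE// => t [Et /andP[t0 t1]]; split=> [r v|v]; first exact: Et.
  set g := coords _ t.
  have diam := hessian_diameter s0 Et.
  have sg : \sum_x g x = tsum t by exact: sum_coords.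
  have cardE : \sum_(x : torus n) (1 : R) = n%:R ^+ 2.
    by rewrite sumr_const card_prod !card_ord natrM expr2.
  have D0 : 0 <= n%:R ^+ 2 * slope_sum s.
    by apply: mulr_ge0; [exact: ltW|apply: sumr_ge0 => r _; rewrite ltW].
  have n21 : 1 <= n%:R ^+ 2 :> R by rewrite exprn_ege1// ler1n.
  have up : g v <= L.
    rewrite leNgt; apply/negP => gv.
    have : \sum_(x : torus n) (1 : R) < \sum_x g x.
      apply: ltr_sum => [|x _]; first by apply/hasP; exists v; rewrite ?mem_index_enum.
      by have := diam v x; rewrite -/g; lra.
    by rewrite cardE sg; lra.
  have lo : - L <= g v.
    rewrite leNgt; apply/negP => gv.
    have : \sum_x g x < \sum_(x : torus n) (- 1 : R).
      apply: ltr_sum => [|x _]; first by apply/hasP; exists v; rewrite ?mem_index_enum.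
      by have := diam x v; rewrite -/g; lra.
    by rewrite sumrN cardE sg; lra.
  by rewrite ler_norml lo up.
have Om_le : (lebesgue_tuple R d.+1 Om <= (2 * n%:R ^+ 2 * L)%:E * lebesgue_tuple R d Q)%E.
  have nL : - (n%:R ^+ 2 * L) <= n%:R ^+ 2 * L.
    by have := mulr_ge0 (ltW n2gt0) L0; lra.
  have := slab _ _ nL; rewrite (_ : _ - - _ = 2 * n%:R ^+ 2 * L); last by ring.
  move=> <-; apply: le_measure; rewrite ?inE// => t [Ht tL]; split; first exact: Ht.
  rewrite /= -ler_norml -(sum_coords t rP) (le_trans (ler_norm_sum _ _ _))//.
  apply: (@le_trans _ _ (\sum_(x : torus n) L)); first by apply: ler_sum => x _; exact: tL.
  by rewrite sumr_const card_prod !card_ord -[leLHS]mulr_natl natrM expr2.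
have Qfin : lebesgue_tuple R d Q = q%:E.
  rewrite /q fineK// ge0_fin_numE ?measure_ge0//.
  by apply: le_lt_trans Q_le _; rewrite -B_E ltry.
have pE : fine (polytope_volume n s) = n%:R * q.
  rewrite /polytope_volume /span_measure (det_gram R n0) natrX sqrtr_sqr ger0_norm//.
  rewrite (_ : _ @^-1` _ = Q).
    by rewrite -/d Qfin.
  pose comb (t : d.-tuple R) x := \sum_(i < d) tnth t i * @mean_zero_basis R n i x.
  have combE t : comb t = coords (@rank n) (cons_pair ((- tsum t)%R : RT, t)).
    apply/funext => v; rewrite /comb /coords /mean_zero_basis -/(rank v) /=.
    have := rk_lt v; case: (rank v) => [|j] /= jd.
      rewrite /tsum -sumrN; apply: eq_bigr => i _.
      by rewrite sub0r mulrN1.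
    rewrite (bigD1 (Ordinal (jd : (j < d)%N))) //= eqxx subr0 mulr1 big1 ?addr0.
      by rewrite (tnth_nth 0).
    move=> i ij; rewrite eqSS subr0 (_ : (j == i) = false) ?mulr0//.
    by apply/eqP => ji; case/eqP: ij; apply/val_inj.
  apply/seteqP; split=> t; rewrite -/(comb t) /= -/(comb t).
    by rewrite combE => -[_ Ht]; exact: Ht.
  move=> Qt; rewrite combE; split; last exact: Qt.
  by rewrite (sum_coords _ rP) tsum_cons addNr.
rewrite pE; split.
  by rewrite ler_wpM2l// -lee_fin B_E -Qfin.
rewrite mulrCA ler_wpM2l// -lee_fin B_E EFinM -Qfin.
exact: Om_le.
Qed.

End polytope.

(** * Sequences that are close along multiples *)

Section convergence_rate.
Context (R : realType).

Definition delta (n : nat) : R := ln n%:R / n%:R.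

Lemma delta_ge0 n : 0 <= delta n.
Proof.
case: n => [|n]; first by rewrite /delta invr0 mulr0.
by rewrite divr_ge0// ln_ge0// ler1n.
Qed.

Lemma delta_le1 n : delta n <= 1.
Proof.
case: n => [|n]; first by rewrite /delta invr0 mulr0.
by rewrite ler_pdivrMr ?ltr0n// mul1r ltW// ln_sublinear// ltr0n.
Qed.

Lemma delta_pow n m j : (0 < n)%N -> (n <= m)%N -> (m <= n ^ j)%N -> delta m <= j%:R * delta n.
Proof.
move=> n0 nm mj; have m0 : (0 < m)%N by exact: leq_trans nm.
have lm : ln (m%:R : R) <= j%:R * ln n%:R.
  rewrite mulr_natl -lnXn ?ltr0n// -natrX ler_ln ?posrE ?ltr0n ?expn_gt0 ?n0//.
  by rewrite ler_nat.
rewrite /delta mulrA; apply: ler_pM => //; first by rewrite ln_ge0// ler1n.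
by rewrite lef_pV2 ?posrE ?ltr0n// ler_nat.
Qed.

(** The logarithm is multiplied by 3 and the size by n^2 >= 4. *)
Lemma delta_cube n : (2 <= n)%N -> delta (n ^ 3) <= 3 / 4 * delta n.
Proof.
move=> n2; have n0 : (0 : R) < n%:R by rewrite ltr0n; lia.
have n2R : (2 : R) <= n%:R by rewrite ler_nat.
have l0 : 0 <= ln (n%:R : R) by rewrite ln_ge0//; lra.
rewrite /delta natrX lnXn// -[ln n%:R *+ 3]mulr_natl.
have -> : 3 * ln n%:R / n%:R ^+ 3 = 3 * (ln n%:R / n%:R) * (n%:R^-1 * n%:R^-1) :> R.
  by field; rewrite gt_eqF.
have i2 : n%:R^-1 * n%:R^-1 <= 4^-1 :> R.
  rewrite -invfM lef_pV2 ?posrE ?mulr_gt0//; nra.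
have d0 : 0 <= ln n%:R / n%:R :> R by rewrite divr_ge0// ltW.
nra.
Qed.

(** Sizes n <= m <= n^3 have the common multiple n m <= n^4; beyond n^3 the error
    is summed along n, n^3, n^9, ..., as a geometric series of ratio 3/4. *)
Lemma rate_of_multiples (z : nat -> R) (C : R) : 0 <= C ->
  (forall n k, (2 <= n)%N -> (0 < k)%N -> (k * n <= n ^ 4)%N ->
     `|z n - z (k * n)%N| <= C * delta n) ->
  forall n m, (2 <= n)%N -> (n <= m)%N -> `|z n - z m| <= 16 * C * delta n.
Proof.
move=> C0 hz.
have short n m : (2 <= n)%N -> (n <= m)%N -> (m <= n ^ 3)%N -> `|z n - z m| <= 4 * C * delta n.
  move=> n2 nm mn.
  have h1 : `|z n - z (m * n)%N| <= C * delta n.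
    by apply: hz => //; [lia|rewrite expnSr leq_mul2r mn orbT].
  have h2 : `|z m - z (m * n)%N| <= C * delta m.
    rewrite mulnC; apply: hz; [lia|lia|].
    rewrite expnSr leq_mul2r; apply/orP; right.
    by rewrite (leq_trans nm)// -[leqLHS]expn1 leq_exp2l//; lia.
  have h3 := @delta_pow n m 3 (ltnW n2) nm mn.
  have : `|z n - z m| <= `|z n - z (m * n)%N| + `|z m - z (m * n)%N|.
    by rewrite [X in _ <= _ + X]distrC; exact: ler_distD.
  have : C * delta m <= C * (3 * delta n) by rewrite ler_wpM2l.
  lra.
have H j : forall n m, (m - n <= j)%N -> (2 <= n)%N -> (n <= m)%N ->
    `|z n - z m| <= 16 * C * delta n.
  elim: j => [|j IHj] n m mj n2 nm.
    have -> : m = n by lia.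
    by rewrite subrr normr0 mulr_ge0 ?delta_ge0// mulr_ge0.
  have [mn|nm3] := leqP m (n ^ 3).
    apply: le_trans (short _ _ n2 nm mn) _.
    by rewrite ler_wpM2r ?delta_ge0//; lra.
  have n3 : (n < n ^ 3)%N by rewrite -[ltnLHS]expn1 ltn_exp2l.
  have h1 := short n (n ^ 3)%N n2 (ltnW n3) (leqnn _).
  have h2 := IHj (n ^ 3)%N m ltac:(lia) ltac:(lia) ltac:(lia).
  have h3 := ler_distD (z (n ^ 3)%N) (z n) (z m).
  have : 16 * C * delta (n ^ 3) <= 16 * C * (3 / 4 * delta n).
    by rewrite ler_wpM2l ?delta_cube// mulr_ge0.
  lra.
by move=> n m; exact: (H (m - n)%N).
Qed.

Lemma delta_small (e : R) : 0 < e -> exists2 n, (2 <= n)%N & delta n <= e.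
Proof.
move=> e0; (* at n = j^2 the quotient is 2 (ln j) / j^2 <= 2 / j *)
pose j := (Num.truncn (2 / e)).+2.
have j0 : (0 : R) < j%:R by rewrite ltr0n.
exists (j ^ 2)%N; first by rewrite (@leq_trans (2 ^ 2))// leq_exp2r.
rewrite /delta natrX lnXn// -[ln j%:R *+ 2]mulr_natl.
have je : 2 / e <= j%:R by rewrite ltW// (lt_trans (truncnS_gt _))// ltr_nat.
have je' : 2 <= e * j%:R by move: je; rewrite ler_pdivrMr// mulrC.
have lj : ln (j%:R : R) <= j%:R by rewrite ltW// ln_sublinear.
rewrite ler_pdivrMr ?exprn_gt0// expr2; nra.
Qed.

Lemma limit_of_rate (z : nat -> R) (C : R) : 0 < C ->
  (forall n m, (2 <= n)%N -> (n <= m)%N -> `|z n - z m| <= C * delta n) ->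
  exists l, (z n @[n --> \oo] --> l) /\ forall n, (2 <= n)%N -> `|z n - l| <= C * delta n.
Proof.
move=> C0 hz.
have : cvgn z.
  apply/cauchy_cvgP/cauchy_exP => e e0.
  have [n n2 dn] := @delta_small (e / (2 * C)) ltac:(by rewrite divr_gt0// mulr_gt0).
  exists (z n); exists n => // m /= nm; rewrite /ball /=.
  apply: le_lt_trans (hz _ _ n2 nm) _.
  apply: le_lt_trans (_ : C * (e / (2 * C)) < e); first by rewrite ler_pM2l.
  by rewrite (_ : C * _ = e / 2); [lra|field; rewrite gt_eqF].
move=> zc; exists (limn z); split=> // n n2.
rewrite distrC ler_distl; apply/andP; split.
  apply: limr_ge => //; exists n => // m /= nm.
  by have := hz _ _ n2 nm; rewrite ler_norml => /andP[? ?]; lra.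
apply: limr_le => //; exists n => // m /= nm.
by have := hz _ _ n2 nm; rewrite ler_norml => /andP[? ?]; lra.
Qed.

(** With t = C ln n / n <= C one has 1 - t <= exp (- t) and
    exp t <= 1 + t exp t <= 1 + t exp C, hence the constant C exp C. *)
Lemma exp_rate (v z : nat -> R) (C : R) : 0 < C ->
  (forall n, (2 <= n)%N -> v n = expR (z n)) ->
  (forall n m, (2 <= n)%N -> (n <= m)%N -> `|z n - z m| <= C * delta n) ->
  exists2 K : R, 0 < K & forall n : nat, (2 <= n)%N ->
    (1 - K * ln n%:R / n%:R) * limn v <= v n /\
    v n <= (1 + K * ln n%:R / n%:R) * limn v.
Proof.
move=> C0 vz hz; have [l [zl hl]] := limit_of_rate C0 hz.
have -> : limn v = expR l.
  apply/cvg_lim => //.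
  have : expR (z n) @[n --> \oo] --> expR l.
    by apply: continuous_cvg => //; exact: continuous_expR.
  apply: cvg_trans; apply: near_eq_cvg; exists 2%N => // n /= n2.
  by rewrite vz.
exists (C * expR C) => [|n n2]; first by rewrite mulr_gt0// expR_gt0.
rewrite -!mulrA -/(delta n) vz//.
have d0 := delta_ge0 n; have d1 := delta_le1 n.
have e0 := expR_gt0 l.
set t := C * delta n.
have t0 : 0 <= t by rewrite mulr_ge0// ltW.
have tC : t <= C by rewrite ler_piMr// ltW.
have := hl n n2; rewrite -/t ler_norml => /andP[h1 h2].
have eC : 1 <= expR C by rewrite -expR0 ler_expR ltW.
have KE : C * (expR C * delta n) = t * expR C by rewrite /t; ring.
rewrite KE; split.
  apply: (@le_trans _ _ (expR (- t) * expR l)).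
    rewrite ler_pM2r//; have := expR_ge1Dx (- t).
    have : t <= t * expR C by rewrite ler_peMr.
    lra.
  by rewrite -expRD ler_expR; lra.
apply: (@le_trans _ _ (expR t * expR l)).
  by rewrite -expRD ler_expR; lra.
rewrite ler_pM2r//.
have g1 : expR t * (1 - t) <= 1.
  have : expR t * (1 - t) <= expR t * expR (- t).
    by rewrite ler_pM2l ?expR_gt0//; exact: expR_ge1Dx.
  by rewrite -expRD subrr expR0.
have : t * expR t <= t * expR C by rewrite ler_wpM2l// ler_expR.
lra.
Qed.

End convergence_rate.

(** * The logarithm of the volume *)

Section volume_growth.
Context (R : realType) (s : 'I_3 -> R) (s_gt0 : forall r, 0 < s r).

Let volume n : R := fine (polytope_volume n s).
Let log_vol n : R := ln (volume n).
Let radius n : R := 2 * (n%:R ^+ 2 * slope_sum s) + 1.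
Let c : R := 2 * slope_sum s + 1.
Let logC : R := ln (3 * c) / ln 2 + 16.

Let total_ge0 : 0 <= slope_sum s.
Proof. by apply: sumr_ge0 => r _; rewrite ltW. Qed.

Let c_ge1 : 1 <= c.
Proof. by move: total_ge0; rewrite /c; lra. Qed.

Let nat_ge1 n : (0 < n)%N -> (1 : R) <= n%:R.
Proof. by rewrite ler1n. Qed.

Let radius_ge1 n : 1 <= radius n.
Proof. by rewrite /radius lerDr mulr_ge0// mulr_ge0// exprn_ge0. Qed.

Let radius_le n : (0 < n)%N -> radius n <= c * n%:R ^+ 2.
Proof.
move=> n0; rewrite /radius /c mulrDl mul1r.
have : (1 : R) <= n%:R ^+ 2 by rewrite exprn_ege1// nat_ge1.
lra.
Qed.

Let radius_mono n m : (n <= m)%N -> radius n <= radius m.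
Proof.
move=> nm; rewrite /radius lerD2r ler_pM2l// ler_wpM2r//.
by rewrite lerXn2r ?nnegrE// ler_nat.
Qed.

Let ln2_gt0 : 0 < ln (2 : R).
Proof. by rewrite ln_gt0// ltr1n. Qed.

Let ln2_le n : (2 <= n)%N -> ln 2 <= ln (n%:R : R).
Proof. by move=> n2; rewrite ler_ln ?posrE ?ltr0n ?ler_nat// ltnW. Qed.

Let logC_ge0 : 0 <= logC.
Proof.
rewrite addr_ge0// divr_ge0// ?(ltW ln2_gt0)// ln_ge0//.
by move: c_ge1; lra.
Qed.

Let ln_poly_le n (w : R) : (2 <= n)%N -> 0 < w -> w <= 3 * c * n%:R ^+ 16 ->
  ln w <= logC * ln n%:R.
Proof.
move=> n2 w0 hw; have n0 : (0 : R) < n%:R by rewrite ltr0n ltnW.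
have c0 : 0 < 3 * c by rewrite mulr_gt0//; move: c_ge1; lra.
apply: (@le_trans _ _ (ln (3 * c * n%:R ^+ 16))).
  by rewrite ler_ln// posrE mulr_gt0// exprn_gt0.
rewrite lnM ?posrE ?exprn_gt0// lnXn// -[ln n%:R *+ 16]mulr_natl /logC (mulrDl (ln (3 * c) / ln 2)) lerD2r.
rewrite mulrAC ler_pdivlMr// ler_wpM2l ?ln2_le// ln_ge0//.
by move: c_ge1; lra.
Qed.

Let lower_slope : exists2 mu : R, 0 < mu <= 1 & forall r, mu <= s r.
Proof.
exists (Num.min 1 (Num.min (s ord0) (Num.min (s (inord 1)) (s (inord 2))))).
  by rewrite !lt_min ltr01 !s_gt0 ge_min lexx.
move=> r; have [->|[->|->]] : r = ord0 \/ r = inord 1 \/ r = inord 2.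
- case: r => [[|[|[|]]]]//= h; [left|right; left|right; right]; apply/val_inj => //=; by rewrite inordK.
- by rewrite !ge_min lexx orbT.
- by rewrite !ge_min lexx !orbT.
- by rewrite !ge_min lexx !orbT.
Qed.

Let cube_le n (e L : R) : 0 <= e -> (forall r, 4 * e <= s r) -> e <= L ->
  (2 * e) ^+ (n * n) <= capped_volume n s L.
Proof.
move=> e0 es eL; rewrite -(vol_cube (rankP n) e0).
have L0 : 0 <= L by exact: le_trans eL.
apply: (vol_le (rankP n) L0) => [|||g ge].
- by refine (@fmeasurable_forall _ _ _ _ _ (fun v => [set g : torus n -> R | `|g v| <= e]) _) => v;
    exact: (@fmeasurable_norm _ _ _ _ (fun g => g v) _ (meval_pt _ _)).
- exact: fmeasurable_capped_set.
- exact: capped_set_bounded.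
split=> [r v|v]; last exact: le_trans (ge v) eL.
rewrite hessianE; case: (rhombus r) => [[[p1 p2] q1] q2]; apply: le_trans (es r).
have := ge (step p1 v); have := ge (step p2 v); have := ge (step q1 v); have := ge (step q2 v).
rewrite !ler_norml => /andP[? ?] /andP[? ?] /andP[? ?] /andP[? ?]; lra.
Qed.

Let volume_gt0 n : (2 <= n)%N -> 0 < volume n.
Proof.
move=> n2; have [mu /andP[mu0 mu1] mus] := lower_slope.
have [_ h] := polytope_volume_bounds (n := n) (s := s) (L := radius n) (ltnW n2) s_gt0 (lexx _).
have B0 : 0 < capped_volume n s (radius n).
  apply: lt_le_trans (cube_le n (e := mu / 4) _ _ _).
  - by rewrite exprn_gt0// mulr_gt0// divr_gt0.
  - by rewrite divr_ge0// ltW.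
  - by move=> r; rewrite mulrC divfK.
  - by have := radius_ge1 n; lra.
have n0 : (0 : R) < n%:R by rewrite ltr0n ltnW.
have r0 : 0 < radius n by have := radius_ge1 n; lra.
have : 0 < 2 * n%:R ^+ 2 * radius n * volume n by apply: lt_le_trans h; rewrite mulr_gt0.
by rewrite pmulr_rgt0// mulr_gt0// mulr_gt0// exprn_gt0.
Qed.

Let log_vol_bounds n L : (2 <= n)%N -> radius n <= L ->
  0 < capped_volume n s L /\ log_vol n <= ln n%:R + ln (capped_volume n s L) /\
  ln n%:R + ln (capped_volume n s L) <= ln (2 * n%:R ^+ 2 * L) + log_vol n.
Proof.
move=> n2 hL.
have [h1 h2] := polytope_volume_bounds (n := n) (s := s) (L := L) (ltnW n2) s_gt0 hL.
have n0 : (0 : R) < n%:R by rewrite ltr0n ltnW.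
have p0 := volume_gt0 n2.
have L0 : 0 < L by have := radius_ge1 n; lra.
have B0 : 0 < capped_volume n s L.
  by rewrite -(pmulr_rgt0 _ n0); exact: lt_le_trans h1.
have nn0 : 0 < 2 * n%:R ^+ 2 * L by rewrite mulr_gt0// mulr_gt0// exprn_gt0.
split=> //; rewrite -lnM ?posrE// -lnM ?posrE//; split.
  by rewrite ler_ln// posrE// mulr_gt0.
by rewrite ler_ln// posrE// mulr_gt0.
Qed.

(** The capped set contains a small cube, on which the Hessian cannot exceed [s],
    and is contained in a cube of side polynomial in [n]. *)
Lemma log_volume_bound : exists2 C : R, 0 <= C &
  forall n, (2 <= n)%N -> `|log_vol n| <= C * n%:R ^+ 2 * ln n%:R.
Proof.
have [mu /andP[mu0 mu1] mus] := lower_slope.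
pose C4 := `|ln (2 * (mu / 4))| / ln 2.
have C40 : 0 <= C4 by rewrite divr_ge0// ltW.
exists (2 * logC + C4) => [|n n2]; first by rewrite addr_ge0// mulr_ge0.
have n0 : (0 : R) < n%:R by rewrite ltr0n ltnW.
have n1 : (1 : R) <= n%:R by rewrite ler1n ltnW.
have n21 : (1 : R) <= n%:R ^+ 2 by rewrite exprn_ege1.
have npow i j : (i <= j)%N -> (n%:R : R) ^+ i <= n%:R ^+ j by move=> ij; rewrite ler_weXn2l.
have ln0 : 0 <= ln (n%:R : R) by rewrite ln_ge0.
have [B0 [h1 h2]] := log_vol_bounds n2 (lexx _).
set B := capped_volume n s (radius n) in B0 h1 h2.
have r1 := radius_ge1 n.
have rc := radius_le (n := n) (ltnW n2).
have up : ln B <= n%:R ^+ 2 * (logC * ln n%:R).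
  apply: (@le_trans _ _ (ln ((2 * radius n) ^+ (n * n)))).
    rewrite ler_ln ?posrE ?exprn_gt0 ?mulr_gt0//; try lra.
    apply: (vol_bounded (rankP n)); [lra|exact: fmeasurable_capped_set|exact: capped_set_bounded].
  rewrite lnXn ?mulr_gt0//; last lra.
  rewrite -[leLHS]mulr_natl natrM -expr2 ler_pM2l ?exprn_gt0//.
  apply: ln_poly_le => //; first by rewrite mulr_gt0//; lra.
  have := npow 2%N 16%N isT; have := c_ge1; nra.
have lo : - (n%:R ^+ 2 * (C4 * ln n%:R)) <= ln B.
  apply: (@le_trans _ _ (ln ((2 * (mu / 4)) ^+ (n * n)))); last first.
    rewrite ler_ln ?posrE ?exprn_gt0 ?mulr_gt0//.
    apply: cube_le; [by rewrite divr_ge0// ltW|by move=> r; rewrite mulrC divfK|].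
    by move: mu1 r1; lra.
  rewrite lnXn ?mulr_gt0// -[leRHS]mulr_natl natrM -expr2 -mulrN ler_pM2l ?exprn_gt0//.
  have : C4 * ln 2 <= C4 * ln n%:R by rewrite ler_wpM2l// ln2_le.
  rewrite {1}/C4 divfK ?gt_eqF//.
  by have := ler_norm (- ln (2 * (mu / 4))); rewrite normrN; lra.
have l1 : ln n%:R <= logC * ln n%:R.
  apply: ln_poly_le => //; have := npow 1%N 16%N isT; have := c_ge1; rewrite expr1; nra.
have l2 : ln (2 * n%:R ^+ 2 * radius n) <= logC * ln n%:R.
  apply: ln_poly_le => //; first by rewrite mulr_gt0 ?mulr_gt0 ?exprn_gt0//; lra.
  have : n%:R ^+ 2 * radius n <= c * n%:R ^+ 4.
    rewrite (_ : c * _ = n%:R ^+ 2 * (c * n%:R ^+ 2)); last by ring.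
    by rewrite ler_pM2l ?exprn_gt0.
  have := npow 4%N 16%N isT; have := c_ge1; nra.
have P1 : 0 <= logC * ln n%:R by rewrite mulr_ge0.
have P4 : 0 <= C4 * ln n%:R by rewrite mulr_ge0.
have E : (2 * logC + C4) * n%:R ^+ 2 * ln n%:R =
    n%:R ^+ 2 * (logC * ln n%:R) + n%:R ^+ 2 * (logC * ln n%:R) +
    n%:R ^+ 2 * (C4 * ln n%:R) by ring.
have Q1 : logC * ln n%:R <= n%:R ^+ 2 * (logC * ln n%:R) by rewrite ler_peMl.
have Q4 : 0 <= n%:R ^+ 2 * (C4 * ln n%:R) by rewrite mulr_ge0// exprn_ge0// ltW.
rewrite E ler_norml; apply/andP; split; lra.
Qed.

(** The logarithms of [capped_volume_pow_le] and [capped_volume_le_pow] with pinning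
    intervals of length 1/n and the cap of the larger torus.  All the sizes that
    occur are at most 3 c n^16, since N <= n^4; so each of their logarithms is a
    multiple of ln n, and after division by N^2 the dominant terms are the 4 n
    boundary points per cell and the dilation by 1 + 8 / (mu n). *)
Lemma comparison_step : exists2 C : R, 0 <= C &
  forall n k, (2 <= n)%N -> (0 < k)%N -> (k * n <= n ^ 4)%N ->
    `|log_vol n / n%:R ^+ 2 - log_vol (k * n)%N / (k * n)%:R ^+ 2| <= C * delta R n.
Proof.
have [mu /andP[mu0 mu1] mus] := lower_slope.
have mu8 : 0 < 8 / mu by rewrite divr_gt0.
exists (6 * logC + 8 / mu / ln 2) => [|n [//|k'] n2 _ kn].
  by apply: addr_ge0; [exact: mulr_ge0|apply: divr_ge0; exact: ltW].
set k := k'.+1 in kn *; set N := (k * n)%N in kn *.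
have n1 := ltnW n2.
have nN : (n <= N)%N by rewrite /N leq_pmull.
have N2 : (2 <= N)%N by exact: leq_trans nN.
have nr0 : (0 : R) < n%:R by rewrite ltr0n.
have nr1 : (1 : R) <= n%:R by rewrite ler1n.
have kr1 : (1 : R) <= k%:R by rewrite ler1n.
have kr0 : (0 : R) < k%:R by rewrite ltr0n.
have Nr : (N%:R : R) = k%:R * n%:R by rewrite /N natrM.
have Nr4 : (N%:R : R) <= n%:R ^+ 4 by rewrite -natrX ler_nat.
have Nr1 : (1 : R) <= N%:R by rewrite ler1n ltnW.
have npow i j : (i <= j)%N -> (n%:R : R) ^+ i <= n%:R ^+ j by move=> ij; rewrite ler_weXn2l.
have nr2 : (n%:R : R) <= N%:R by rewrite ler_nat.
pose L := radius N.
have L1 : 1 <= L by exact: radius_ge1.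
have L0 : 0 <= L by exact: le_trans ler01 L1.
have Lc : L <= c * n%:R ^+ 8.
  apply: le_trans (radius_le (ltnW N2)) _; rewrite ler_wpM2l ?(le_trans ler01 c_ge1)//.
  by rewrite (_ : 8 = 4 * 2)%N// exprM lerXn2r ?nnegrE ?exprn_ge0.
pose eta : R := n%:R^-1.
have eta0 : 0 < eta by rewrite invr_gt0.
pose m := (Num.truncn (2 * L * n%:R)).+1.
have mL : 2 * L <= m%:R * eta by rewrite ler_pdivlMr// ltW// truncnS_gt.
have m0 : (0 < m)%N by [].
have mle : (m%:R : R) <= 3 * c * n%:R ^+ 16.
  have : (m%:R : R) <= 2 * L * n%:R + 1.
    by rewrite /m -[leLHS]natr1 lerD2r truncn_le mulr_ge0// mulr_ge0.
  have h1 : L * n%:R <= c * n%:R ^+ 16.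
    apply: (@le_trans _ _ (c * n%:R ^+ 8 * n%:R)); first by rewrite ler_wpM2r// ltW.
    rewrite -mulrA -exprSr ler_wpM2l ?npow//; exact: le_trans ler01 c_ge1.
  have h2 : 1 <= c * n%:R ^+ 16.
    by rewrite -[leLHS]mulr1 ler_pM ?c_ge1// exprn_ege1.
  lra.
set la := logC * ln n%:R.
have la0 : 0 <= la by rewrite mulr_ge0// ln_ge0.
have lm : ln (m%:R : R) <= la by apply: ln_poly_le => //; rewrite ltr0n.
have small j (u : R) : (j <= 8)%N -> 0 < u -> u <= 3 * n%:R ^+ j * L -> ln u <= la.
  move=> j8 u0 hu; apply: ln_poly_le => //; apply: le_trans hu _.
  rewrite -!mulrA ler_pM2l//.
  apply: (@le_trans _ _ (n%:R ^+ 8 * (c * n%:R ^+ 8))).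
    by rewrite ler_pM ?npow// exprn_ge0// ltW.
  by rewrite mulrCA -exprD.
have nL2 : ln (2 * n%:R ^+ 2 * L) <= la.
  apply: (small 2%N) => //; first by rewrite mulr_gt0 ?mulr_gt0 ?exprn_gt0//; lra.
  by rewrite ler_wpM2r// ler_wpM2r ?exprn_ge0// ?(ltW nr0)// ler_nat.
have NL2 : ln (2 * N%:R ^+ 2 * L) <= la.
  apply: (small 8%N) => //; first by rewrite mulr_gt0 ?mulr_gt0 ?exprn_gt0//; lra.
  rewrite ler_wpM2r//.
  have : (N%:R : R) ^+ 2 <= n%:R ^+ 8.
    by rewrite (_ : 8 = 4 * 2)%N// exprM lerXn2r ?nnegrE ?exprn_ge0.
  have : (0 : R) <= N%:R ^+ 2 by rewrite exprn_ge0.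
  lra.
have [Bn0 [xn1 xn2]] := log_vol_bounds n2 (radius_mono nN : radius n <= L).
have [BN0 [xN1 xN2]] := log_vol_bounds N2 (lexx _ : radius N <= L).
have lnn : 0 <= ln (n%:R : R) by rewrite ln_ge0.
have lnN : 0 <= ln (N%:R : R) by rewrite ln_ge0.
have lN : ln (N%:R : R) <= la.
  apply: (small 4%N); rewrite ?ltr0n ?(ltnW N2)//.
  apply: le_trans Nr4 _.
  have : 1 <= 3 * L by lra.
  by rewrite mulrAC => h; rewrite ler_peMl// exprn_ge0// ltW.
have ln_n : ln (n%:R : R) <= la.
  by apply: le_trans lN; rewrite ler_ln ?posrE ?ltr0n// ltnW.
set Bn := capped_volume n s L in Bn0 xn1 xn2; set BN := capped_volume N s L in BN0 xN1 xN2.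
pose rho : R := 1 + 8 / mu / n%:R.
have rho1 : 1 <= rho by rewrite /rho lerDl divr_ge0// ltW.
have rho0 : 0 < rho by lra.
have lrho : ln rho <= 8 / mu / n%:R.
  by apply: le_ln1Dx; apply: (@lt_le_trans _ _ 0); rewrite ?ltrN10// divr_ge0// ltW.
have relax q : capped_volume q (fun r => s r + 8 * eta) L <= rho ^+ (q * q) * capped_volume q s L.
  rewrite -capped_volume_scale//; apply: capped_volume_le.
  - by rewrite mulr_ge0// ltW.
  - move=> r; have h : 1 <= s r / mu by rewrite ler_pdivlMr// mul1r.
    have -> : rho * s r = s r + 8 * eta * (s r / mu).
      by rewrite /rho /eta; field; rewrite !gt_eqF.
    by rewrite lerD2l ler_peMr// mulr_ge0// ltW.
  - by rewrite ler_peMl.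
have M0 : (0 : R) < (m ^ (4 * n))%:R ^+ (k * k) by rewrite exprn_gt0// ltr0n expn_gt0.
have lM : ln ((m ^ (4 * n))%:R ^+ (k * k) : R) <= k%:R ^+ 2 * (4 * n%:R * la).
  have E : ((4 * n * (k * k))%:R : R) = k%:R ^+ 2 * (4 * n%:R) by rewrite !natrM; ring.
  rewrite natrX -exprM lnXn ?ltr0n// -[leLHS]mulr_natl E -[leLHS]mulrA.
  by rewrite ler_wpM2l ?exprn_ge0// ler_wpM2l// mulr_ge0// ltW.
have rhoX q : 0 < rho ^+ q by rewrite exprn_gt0.
have lrhoX q : ln (rho ^+ (q * q)) = q%:R ^+ 2 * ln rho.
  by rewrite lnXn// -[LHS]mulr_natl natrM -expr2.
have A : k%:R ^+ 2 * ln Bn <= k%:R ^+ 2 * (4 * n%:R * la) + (N%:R ^+ 2 * ln rho + ln BN).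
  have h := le_trans (@capped_volume_pow_le R k' n n1 s L eta m L0 eta0 m0 mL)
    (ler_wpM2l (ltW M0) (relax N)).
  have : ln (Bn ^+ (k * k)) <= ln ((m ^ (4 * n))%:R ^+ (k * k) * (rho ^+ (N * N) * BN)).
    by rewrite ler_ln// posrE ?exprn_gt0// mulr_gt0// mulr_gt0.
  rewrite lnXn// -[leLHS]mulr_natl natrM -expr2 lnM ?posrE ?mulr_gt0//.
  rewrite lnM ?posrE// lrhoX; lra.
have B : ln BN <= k%:R ^+ 2 * (4 * n%:R * la) + k%:R ^+ 2 * (n%:R ^+ 2 * ln rho + ln Bn).
  have h := @capped_volume_le_pow R k' n n1 s L eta m L0 eta0 m0 mL.
  have X0 : 0 < (rho ^+ (n * n) * Bn) ^+ (k * k) by rewrite exprn_gt0// mulr_gt0.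
  have : ln BN <= ln ((m ^ (4 * n))%:R ^+ (k * k) * (rho ^+ (n * n) * Bn) ^+ (k * k)).
    rewrite ler_ln ?posrE ?(mulr_gt0 M0 X0)//.
    apply: le_trans h _; rewrite ler_wpM2l ?(ltW M0)// lerXn2r ?nnegrE ?capped_volume_ge0//.
    by rewrite mulr_ge0// ltW.
  rewrite lnM ?posrE// (lnXn (k * k) (mulr_gt0 (rhoX (n * n)%N) Bn0)).
  rewrite -[ln (rho ^+ (n * n) * Bn) *+ (k * k)]mulr_natl natrM -expr2. rewrite lnM ?posrE//.
  rewrite lrhoX; lra.
have k21 : (1 : R) <= k%:R ^+ 2 by rewrite exprn_ege1.
have N2pos : (0 : R) < N%:R ^+ 2 by rewrite exprn_gt0//; lra.
have NE : (N%:R : R) ^+ 2 = k%:R ^+ 2 * n%:R ^+ 2 by rewrite Nr exprMn.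
have rn : n%:R ^+ 2 * ln rho <= n%:R * (8 / mu).
  have -> : n%:R * (8 / mu) = n%:R ^+ 2 * (8 / mu / n%:R) by field; rewrite !gt_eqF.
  by rewrite ler_wpM2l// exprn_ge0// ltW.
have kla : la <= k%:R ^+ 2 * la by rewrite ler_peMl.
have nla : la <= n%:R * la by rewrite ler_peMl.
have knla : k%:R ^+ 2 * la <= k%:R ^+ 2 * (n%:R * la) by rewrite ler_wpM2l// exprn_ge0// ltW.
have krn : N%:R ^+ 2 * ln rho <= k%:R ^+ 2 * (n%:R * (8 / mu)).
  by rewrite NE -mulrA ler_wpM2l// exprn_ge0// ltW.
have krn' : k%:R ^+ 2 * (n%:R ^+ 2 * ln rho) <= k%:R ^+ 2 * (n%:R * (8 / mu)).
  by rewrite ler_wpM2l// exprn_ge0// ltW.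
pose T := 6 * (n%:R * la) + n%:R * (8 / mu).
have U1 : k%:R ^+ 2 * log_vol n <= log_vol N + k%:R ^+ 2 * T.
  have : k%:R ^+ 2 * log_vol n <= k%:R ^+ 2 * (la + ln Bn).
    by rewrite ler_wpM2l ?exprn_ge0//; lra.
  rewrite /T; lra.
have U2 : log_vol N <= k%:R ^+ 2 * log_vol n + k%:R ^+ 2 * T.
  have : k%:R ^+ 2 * ln Bn <= k%:R ^+ 2 * (la + log_vol n).
    by rewrite ler_wpM2l ?exprn_ge0//; lra.
  rewrite /T; lra.
have -> : log_vol n / n%:R ^+ 2 - log_vol N / N%:R ^+ 2 =
    (k%:R ^+ 2 * log_vol n - log_vol N) / N%:R ^+ 2.
  by rewrite NE; field; rewrite !gt_eqF.
rewrite normrM (gtr0_norm (x := (N%:R ^+ 2)^-1)) ?invr_gt0// ler_pdivrMr//.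
apply: (@le_trans _ _ (k%:R ^+ 2 * T)).
  by rewrite ler_norml; apply/andP; split; lra.
have -> : k%:R ^+ 2 * T = (6 * la + 8 / mu) / n%:R * N%:R ^+ 2.
  by rewrite NE /T; field; rewrite !gt_eqF.
rewrite ler_wpM2r ?(ltW N2pos)// /delta mulrA ler_wpM2r ?invr_ge0 ?(ltW nr0)//.
have : 8 / mu <= 8 / mu / ln 2 * ln n%:R.
  by rewrite mulrAC ler_pdivlMr// ler_wpM2l ?(ltW mu8)// ln2_le.
rewrite /la; lra.
Qed.

Lemma volume_root_expE n : (2 <= n)%N -> volume_root s n = expR (log_vol n / (n ^ 2 - 1)%:R).
Proof.
move=> n2; have p0 := volume_gt0 n2.
by rewrite /volume_root /powR gt_eqF// mulrC.
Qed.

(** The exponents 1/n^2 and 1/(n^2 - 1) differ by 1/(n^2 (n^2 - 1)); since the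
    logarithm of the volume is of order n^2 ln n, exchanging them changes it by a
    term of order (ln n) / n^2. *)
Lemma log_volume_root_step : exists2 C : R, 0 <= C &
  forall n k, (2 <= n)%N -> (0 < k)%N -> (k * n <= n ^ 4)%N ->
    `|log_vol n / (n ^ 2 - 1)%:R - log_vol (k * n)%N / ((k * n) ^ 2 - 1)%:R| <= C * delta R n.
Proof.
have [C C0 hC] := comparison_step.
have [D D0 hD] := log_volume_bound.
have adjust n : (2 <= n)%N ->
    `|log_vol n / (n ^ 2 - 1)%:R - log_vol n / n%:R ^+ 2| <= D * delta R n.
  move=> n2; have nr2 : (2 : R) <= n%:R by rewrite ler_nat.
  have nr0 : (0 : R) < n%:R by lra.
  have n2n : (n%:R : R) <= n%:R ^+ 2 - 1 by rewrite expr2; nra.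
  have d0 : (0 : R) < n%:R ^+ 2 - 1 by exact: lt_le_trans n2n.
  have -> : ((n ^ 2 - 1)%:R : R) = n%:R ^+ 2 - 1.
    by rewrite natrB ?natrX// expn_gt0 (ltnW n2).
  have -> : log_vol n / (n%:R ^+ 2 - 1) - log_vol n / n%:R ^+ 2 =
      log_vol n / (n%:R ^+ 2 * (n%:R ^+ 2 - 1)).
    by field; rewrite !gt_eqF.
  have nn0 : 0 < n%:R ^+ 2 * (n%:R ^+ 2 - 1) :> R by rewrite mulr_gt0// exprn_gt0.
  rewrite normrM (gtr0_norm (x := (_ * _)^-1)) ?invr_gt0// ler_pdivrMr//.
  apply: le_trans (hD n n2) _.
  have -> : D * delta R n * (n%:R ^+ 2 * (n%:R ^+ 2 - 1)) =
     D * (n%:R * ln n%:R) * (n%:R ^+ 2 - 1).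
    by rewrite /delta; field; rewrite !gt_eqF.
  have -> : D * n%:R ^+ 2 * ln n%:R = D * (n%:R * ln n%:R) * n%:R by ring.
  rewrite ler_wpM2l//; apply: mulr_ge0 => //; apply: mulr_ge0; first exact: ltW.
  by rewrite ln_ge0//; lra.
exists (C + 5 * D) => [|n k n2 k0 kn]; first by rewrite addr_ge0// mulr_ge0.
have nN : (n <= k * n)%N by rewrite leq_pmull.
have N2 : (2 <= k * n)%N by exact: leq_trans nN.
have h1 := hC n k n2 k0 kn.
have h2 := adjust n n2.
have h3 := adjust (k * n)%N N2.
have h4 : D * delta R (k * n) <= D * (4%:R * delta R n).
  by rewrite ler_wpM2l// delta_pow// ltnW.
move: h1 h2 h3; rewrite !ler_norml => /andP[? ?] /andP[? ?] /andP[? ?].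
apply/andP; split; lra.
Qed.

End volume_growth.

Theorem corollary3p14 (R : realType) (s : 'I_3 -> R) (s_gt0 : forall r, 0 < s r) :
  exists2 C : R, 0 < C & forall n : nat, (2 <= n)%N ->
    (1 - C * ln n%:R / n%:R) * volume_root_lim s <= volume_root s n /\
    volume_root s n <= (1 + C * ln n%:R / n%:R) * volume_root_lim s.
Proof.
have [C C0 hC] := log_volume_root_step s_gt0.
apply: (@exp_rate R (volume_root s)
  (fun n => ln (fine (polytope_volume n s)) / (n ^ 2 - 1)%:R) (16 * C + 1)).
- by rewrite ltr_wpDl// mulr_ge0.
- by move=> n; exact: volume_root_expE.
move=> n m n2 nm.
apply: le_trans (rate_of_multiples C0 hC n2 nm) _.
by rewrite ler_wpM2r ?delta_ge0// lerDl.
Qed.
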